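(* Let $m\geq 1$ be an integer, let $(S,d)$ be a separable metric space, let $(X_i)_{i\in\mathbb Z}=(X_0\circ T^i)_{i\in\mathbb Z}$ be a strictly stationary sequence with values in $S$ and let $p\geq 1$. Suppose that the measurable function $h\colon S^m\to\mathbb R$ satisfies the following assumptions: (1) $h$ is symmetric, that is, $h(x_{\sigma(1)},\dots,x_{\sigma(m)})=h(x_1,\dots,x_m)$ for all $x_1,\dots,x_m\in S$ and each bijection $\sigma\colon\{1,\dots,m\}\to\{1,\dots,m\}$; (2) the family $\{|h(X_{i_1},\dots,X_{i_m})|^p : 1\leq i_1<\dots<i_m\}$ is uniformly integrable; (3) the integral $\int_\Omega\int_{S^m}|h(x_1,\dots,x_m)|^p\,d\mu_\omega(x_1)\cdots d\mu_\omega(x_m)\,d\mathbb P(\omega)$ is finite; (4) for almost every $\omega\in\Omega$, $I_m(S,\mathbf 1_{D(h)},\omega)=0$, where $D(h)\subset S^m$ denotes the set of discontinuity points of $h$. Then $$\lim_{n\to\infty}\left\|U_{m,n,h}-I_m(S,h,\cdot)\right\|_p=0.$$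
   Context: $(\Omega,\mathcal F,\mathbb P)$ is a probability space and $T\colon\Omega\to\Omega$ is a measure-preserving map (invertible with measurable inverse, so that $T^i$ makes sense for all $i\in\mathbb Z$). $X_0\colon\Omega\to S$ is measurable for the Borel $\sigma$-algebra $\mathcal B(S)$ and $X_i=X_0\circ T^i$. No ergodicity is assumed. For $n\geq m$, the $U$-statistic of order $m$ with kernel $h$ is $$U_{m,n,h}=\frac1{\binom nm}\sum_{1\leq i_1<i_2<\dots<i_m\leq n}h(X_{i_1},\dots,X_{i_m}).$$ $\mathcal I$ denotes the $\sigma$-algebra of invariant sets, i.e. the sets $E\in\mathcal F$ such that $T^{-1}E=E$. The random probability measure $\mu_\omega$ on $\mathcal B(S)$ is defined by $\mu_\omega(A)=\mathbb E[\mathbf 1_{X_0\in A}\mid\mathcal I](\omega)$, $A\in\mathcal B(S)$ (a regular conditional distribution of $X_0$ given $\mathcal I$). For a function $g\colon S^m\to\mathbb R$, $$I_m(S,g,\omega)=\int_{S^m}g(x_1,\dots,x_m)\,d\mu_\omega(x_1)\cdots d\mu_\omega(x_m),$$ and $I_m(S,g,\cdot)$ denotes the random variable $\omega\mapsto I_m(S,g,\omega)$. For a real random variable $Z$, $\|Z\|_p=(\mathbb E[|Z|^p])^{1/p}$. *)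

(* Defs.v *)
From HB Require Import structures.
From mathcomp Require Import all_boot all_order all_algebra.
From mathcomp Require Import all_classical all_reals all_analysis.
From mathcomp Require Import measurable_realfun random_variable.

Set Implicit Arguments.
Unset Strict Implicit.
Unset Printing Implicit Defensive.

Import Order.TTheory GRing.Theory Num.Theory.
Import numFieldNormedType.Exports.

Local Open Scope classical_set_scope.
Local Open Scope ring_scope.

(* Measurable types carry a distinguished point, hence so must S; a metric space
   in which a random element takes values is nonempty, so nothing is lost. *)
#[short(type="pmetricType")]
HB.structure Definition PointedMetric (K : numDomainType) :=
  { M of Metric K M & Pointed M }.

Notation borel S := (g_sigma_algebraType (@open S)).

Section product_power.
Context (d : measure_display) (S : measurableType d) (R : realType).

Definition tcons (n : nat) (x : S * n.-tuple S) : n.+1.-tuple S :=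
  [tuple of x.1 :: x.2].

Lemma measurable_tcons (n : nat) : measurable_fun setT (@tcons n).
Proof. exact: measurable_cons. Qed.

HB.instance Definition _ (n : nat) :=
  isMeasurableFun.Build _ _ _ _ (@tcons n) (@measurable_tcons n).

(* The m-fold product nu (x) ... (x) nu on S^m: the image of
   nu (x) nu^(m-1) under (x_1, (x_2, .., x_m)) |-> (x_1, .., x_m). *)
Fixpoint power_prob (nu : probability S R) (m : nat) :
    probability (m.-tuple S) R :=
  match m with
  | 0 => \d_([tuple] : 0.-tuple S)
  | k.+1 => distribution (nu \x power_prob nu k)%E (@tcons k)
  end.

Definition multi_integral (nu : probability S R) (m : nat) (g : m.-tuple S -> R) :
    \bar R :=
  (\int[power_prob nu m]_x (g x)%:E)%E.

End product_power.

(* S^m carries the product topology; {ptws 'I_m -> S} is the library's product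
   space, identified with m.-tuple S. *)
Definition discontinuity_set (S : topologicalType) (R : realType) (m : nat)
    (h : m.-tuple S -> R) : set (m.-tuple S) :=
  [set t | ~ {for (tnth t : {ptws 'I_m -> S}),
    continuous (fun x : {ptws 'I_m -> S} => h [tuple x j | j < m])}].

Definition symmetric_kernel (S R : Type) (m : nat) (h : m.-tuple S -> R) :=
  forall (s : 'I_m -> 'I_m) (x : m.-tuple S), bijective s ->
    h [tuple tnth x (s j) | j < m] = h x.

Section stationary.
Context (d : measure_display) (Omega : measurableType d) (R : realType).
Implicit Type P : probability Omega R.

Definition measure_preserving P (T : Omega -> Omega) :=
  measurable_fun setT T /\ forall A, measurable A -> P (T @^-1` A) = P A.

Definition int_iter (T Tinv : Omega -> Omega) (i : int) : Omega -> Omega :=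
  match i with
  | Posz n => iter n T
  | Negz n => iter n.+1 Tinv
  end.

Definition invariant_sets (T : Omega -> Omega) : set (set Omega) :=
  [set E | measurable E /\ T @^-1` E = E].

(* Z is a version of E[Y | G]; G is meant to be a sub-sigma-algebra. *)
Definition is_cond_expectation P (G : set (set Omega)) (Y Z : Omega -> \bar R) :=
  [/\ measurable_fun [set: g_sigma_algebraType G] Z,
      P.-integrable setT Z
    & forall E, G E -> (\int[P]_(w in E) Z w = \int[P]_(w in E) Y w)%E].

Definition is_regular_cond_distribution (d' : measure_display)
    (S : measurableType d') P (G : set (set Omega)) (X : Omega -> S)
    (mu : Omega -> probability S R) :=
  forall A : set S, measurable A ->
    is_cond_expectation P G (fun w => (\1_(X @^-1` A) w)%:E) (fun w => mu w A).

Definition uniformly_integrable P (J : Type) (D : set J)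
    (Y : J -> Omega -> R) :=
  forall e : R, 0 < e -> exists K : R, forall j, D j ->
    (\int[P]_(w in [set w | (K < `|Y j w|)%R]) `|Y j w|%:E <= e%:E)%E.

(* [path ltn 0 i] reads 1 <= i_1 < ... < i_m. *)
Definition ustat (S : Type) (X : int -> Omega -> S) (m : nat)
    (h : m.-tuple S -> R) (n : nat) (w : Omega) : R :=
  ('C(n, m)%:R)^-1 *
  \sum_(i : m.-tuple 'I_n.+1 | path ltn 0%N (map val i))
    h [tuple X (tnth i j : nat)%:Z w | j < m].

End stationary.

(* Main.v *)
Require Import Defs.
From HB Require Import structures.
From mathcomp Require Import all_boot all_order all_algebra.
From mathcomp Require Import all_classical all_reals all_analysis.
From mathcomp Require Import measurable_realfun random_variable giry.
From mathcomp Require Import perm lra.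

Set Implicit Arguments.
Unset Strict Implicit.
Unset Printing Implicit Defensive.

Import Order.TTheory GRing.Theory Num.Theory.
Import numFieldNormedType.Exports.

Local Open Scope classical_set_scope.
Local Open Scope ring_scope.

(** The theorem is a law of large numbers for U-statistics: the kernel is
    averaged over tuples of sample points, and the empirical measure of the
    sample [X_1, .., X_n] converges to the random measure [mu w].

    Convergence of the empirical measures is the pointwise ergodic theorem for
    indicator functions ([empirical_cvg]): for each Borel set [A] the frequency
    of visits of [X_i] to [A] tends almost surely to [mu w A], which is
    [T]-invariant and has the same integrals as the indicator of [X_0 \in A]
    over invariant events.  It is proved from the maximal ergodic inequality
    ([maximal_ergodic], by the argument of Garsia).

    From frequencies to kernels.  Separability gives a countable base
    [B_0, B_1, ..]; the first [N] base sets cut [S] into finitely many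
    cells, labelled by the code of a point.  A kernel that depends only on the
    codes of its arguments has averages that are polynomials in finitely many
    frequencies, and its integral against the product measure is the same
    polynomial in the cell probabilities ([Vstat_code_fun],
    [Rintegral_code_fun]).  A bounded kernel [h] is compared with its value at
    a representative of the cell of its argument: the error is the oscillation
    of [h] over the cell, which tends to [0] as [N] grows at each continuity
    point of [h], hence in mean for the product measure.  So averages over all
    tuples of indices converge almost surely ([Vstat_cvg]).  Tuples with a
    repeated index are asymptotically negligible ([uniq_average_cvg]), and for
    a symmetric kernel the average over tuples without repetition is the
    U-statistic ([ustatE]).

    From bounded kernels to [h].  Clipping [h] at level [K] preserves
    symmetry and creates no discontinuity, so dominated convergence gives the
    claim in L^p for the clipped kernel.  The rest is at most [|h|] on
    [|h| > K] and [0] elsewhere; its contribution to the U-statistic is small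
    uniformly in [n] by uniform integrability, and its contribution to the
    limit is small because [|h|^p] is integrable for the mixture of the
    product measures.  Both bounds move the power [p] inside an average by a
    form of Jensen's inequality with constant [2^p] ([powR_le_of_add]). *)

(** * Integrals of bounded functions *)

Section bounded_integrals.
Context (d : measure_display) (Omega : measurableType d) (R : realType)
  (P : probability Omega R).
Implicit Types (f g : Omega -> R) (C : R).

Lemma bounded_integrable f C : measurable_fun setT f ->
  (forall w, `|f w| <= C) -> P.-integrable setT (EFin \o f).
Proof.
move=> mf fC; apply: measurable_bounded_integrable => //.
  by rewrite /= -(@fineK _ (P setT)) ?ltry ?fin_num_measure.
exists C; split; first exact: num_real.
by move=> M CM w _ /=; rewrite (le_trans (fC w))// ltW.
Qed.

Lemma measurable_ltr_set f g : measurable_fun setT f -> measurable_fun setT g ->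
  measurable [set w | f w < g w].
Proof.
move=> mf mg; rewrite -[X in measurable X]setTI.
exact: (measurable_fun_ltr mf mg measurableT (Y := [set true])).
Qed.

Lemma Rintegral_cvg_bounded (f_ : nat -> Omega -> R) f C :
  (forall n, measurable_fun setT (f_ n)) -> measurable_fun setT f ->
  {ae P, forall w, f_ n w @[n --> \oo] --> f w} ->
  (forall n w, `|f_ n w| <= C) ->
  \int[P]_w f_ n w @[n --> \oo] --> \int[P]_w f w.
Proof.
move=> mf_ mf cvf bf.
have [|||||intf _ cvI] := @dominated_convergence _ _ _ P setT measurableT
  (fun n => EFin \o f_ n) (EFin \o f) (EFin \o cst C).
- by move=> n; apply/measurable_EFinP.
- exact/measurable_EFinP.
- by apply: filterS cvf => w cvw _; apply/fine_cvgP; split => //; exact: nearW.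
- by apply: (@bounded_integrable _ `|C|).
- by apply: aeW => w n _ /=; rewrite lee_fin.
by apply: fine_cvg; rewrite fineK //; exact: integrable_fin_num.
Qed.

End bounded_integrals.

(** * The pointwise ergodic theorem for bounded functions *)

Section birkhoff.
Context (d : measure_display) (Omega : measurableType d) (R : realType)
  (P : probability Omega R) (T : Omega -> Omega).
Hypothesis T_mp : measure_preserving P T.
Implicit Types (f g : Omega -> R) (C : R).

Let mT : measurable_fun setT T. Proof. by case: T_mp. Qed.

Lemma measurable_iter n : measurable_fun setT (iter n T).
Proof. by elim: n => [|n IHn]; [exact: measurable_id|exact: measurableT_comp]. Qed.

Lemma ge0_integral_measure_preserving (f : Omega -> \bar R) : measurable_fun setT f ->
  (forall w, (0 <= f w)%E) -> (\int[P]_w f (T w) = \int[P]_w f w)%E.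
Proof.
move=> mf f0.
have := @ge0_integral_pushforward _ _ _ _ _ T mT P setT f measurableT mf.
rewrite preimage_setT => <- //.
apply: (eq_measure_integral P) => A mA _.
by rewrite /= /pushforward; case: T_mp => _; apply.
Qed.

Lemma integral_measure_preserving (f : Omega -> \bar R) : measurable_fun setT f ->
  (\int[P]_w f (T w) = \int[P]_w f w)%E.
Proof.
move=> mf; rewrite integralE [RHS]integralE; congr (_ - _)%E.
  have := @ge0_integral_measure_preserving f^\+%E (measurable_funepos mf).
  by move=> <- //; apply: eq_integral => w _; rewrite !funeposE.
have := @ge0_integral_measure_preserving f^\-%E (measurable_funeneg mf).
by move=> <- //; apply: eq_integral => w _; rewrite !funenegE.
Qed.

Definition birkhoff_sum f n w := \sum_(i < n) f (iter i T w).

Lemma birkhoff_sumS f n w :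
  birkhoff_sum f n.+1 w = f w + birkhoff_sum f n (T w).
Proof.
rewrite /birkhoff_sum big_ord_recl; congr (_ + _).
by apply: eq_bigr => i _; rewrite -iterSr.
Qed.

Lemma measurable_birkhoff_sum f n : measurable_fun setT f ->
  measurable_fun setT (birkhoff_sum f n).
Proof.
move=> mf; apply: measurable_sum => i.
by apply: measurableT_comp => //; exact: measurable_iter.
Qed.

(** The maximum of the Birkhoff sums of [f] at [w] with at most [n] terms; the
    recursion expresses it through the orbit of [T w], which is what the
    maximal ergodic inequality uses. *)
Fixpoint birkhoff_max f n w : R :=
  if n is k.+1 then Num.max 0 (f w + birkhoff_max f k (T w)) else 0.

Lemma birkhoff_max_ge0 f n w : 0 <= birkhoff_max f n w.
Proof. by case: n => //= n; rewrite le_max lexx. Qed.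

Lemma birkhoff_max_ge f n w : birkhoff_sum f n w <= birkhoff_max f n w.
Proof.
elim: n w => [|n IHn] w; first by rewrite /birkhoff_sum big_ord0.
by rewrite birkhoff_sumS /= le_max lerD2l IHn orbT.
Qed.

Lemma birkhoff_max_homo f w :
  {homo birkhoff_max f ^~ w : n m / (n <= m)%N >-> n <= m}.
Proof.
apply: homo_leq => // [x y z|n]; first exact: le_trans.
elim: n w => [|n IHn] w; first exact: birkhoff_max_ge0.
by rewrite [leRHS]/= [leLHS]/= ge_max le_max lexx/= le_max lerD2l IHn orbT.
Qed.

Lemma birkhoff_max_le f C n w : (forall w, `|f w| <= C) ->
  birkhoff_max f n w <= C *+ n.
Proof.
move=> fC; elim: n w => [//|n IHn] w /=.
rewrite ge_max mulrS addr_ge0 ?mulrn_wge0 ?(le_trans _ (fC w))//=.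
by rewrite lerD ?IHn // (le_trans (ler_norm _)).
Qed.

Lemma measurable_birkhoff_max f n : measurable_fun setT f ->
  measurable_fun setT (birkhoff_max f n).
Proof.
move=> mf; elim: n => [|n IHn]; first exact: measurable_cst.
apply: (@measurable_maxr _ _ _ setT (cst 0)); first exact: measurable_cst.
by apply: measurable_funD => //; exact: measurableT_comp.
Qed.

(** With [M_n] the running maximum of the Birkhoff sums of [g], one has
    [M_(n+1) w - M_(n+1) (T w) <= g w] where [M_(n+1) w > 0], and
    [M_(n+1) w - M_(n+1) (T w) <= 0] elsewhere; the left-hand side has integral
    [0].  The last hypothesis makes the sets [M_n > 0] exhaust the support of
    [g]; it holds when [g] is cut off to the invariant set where its Birkhoff
    sums are unbounded above. *)
Lemma maximal_ergodic g C : measurable_fun setT g -> (forall w, `|g w| <= C) ->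
  (forall w, g w != 0 -> exists n, 0 < birkhoff_sum g n w) ->
  0 <= \int[P]_w g w.
Proof.
move=> mg gC gpos.
have C0 : 0 <= C by rewrite (le_trans _ (gC point)).
pose pos n := [set w | 0 < birkhoff_max g n w].
pose h n w := g w * \1_(pos n) w.
have mpos n : measurable (pos n).
  apply: measurable_ltr_set; first exact: measurable_cst.
  exact: measurable_birkhoff_max.
have mh n : measurable_fun setT (h n).
  by apply: measurable_funM => //; exact: measurable_indic.
have hC n w : `|h n w| <= C.
  rewrite /h normrM (le_trans _ (gC w))// ler_piMr//.
  by rewrite indicE; case: (_ \in _); rewrite ?normr1 ?normr0.
have hge0 n : 0 <= \int[P]_w h n.+1 w.
  have Mb w : `|birkhoff_max g n.+1 w| <= C *+ n.+1.
    by rewrite ger0_norm ?birkhoff_max_ge0 ?birkhoff_max_le.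
  have mM := measurable_birkhoff_max n.+1 mg.
  have iM := bounded_integrable P mM Mb.
  have iMT : P.-integrable setT (EFin \o (birkhoff_max g n.+1 \o T)).
    apply: (bounded_integrable P (C := C *+ n.+1)) => [|w]; last exact: Mb.
    exact: measurableT_comp.
  have <- : \int[P]_w (birkhoff_max g n.+1 w - birkhoff_max g n.+1 (T w)) = 0.
    rewrite RintegralB//; apply/eqP; rewrite subr_eq0 /Rintegral; apply/eqP.
    congr fine; rewrite -(integral_measure_preserving (f := EFin \o birkhoff_max g n.+1))//.
    exact/measurable_EFinP.
  apply: le_Rintegral => //.
  - apply: (bounded_integrable P (C := C *+ n.+1 + C *+ n.+1)).
      by apply: measurable_funB => //; exact: measurableT_comp.
    by move=> w; rewrite (le_trans (ler_normB _ _))// lerD.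
  - exact: bounded_integrable (mh _) (hC _).
  move=> w _; rewrite /h indicE; have [Mpos|Mle] := ltP 0 (birkhoff_max g n.+1 w).
  - rewrite mem_set //= mulr1.
    have -> : Num.max 0 (g w + birkhoff_max g n (T w)) =
              g w + birkhoff_max g n (T w).
      by apply/max_idPr; move: Mpos; rewrite /= lt_max ltxx /=; exact: ltW.
    rewrite -addrA gerDl subr_le0; exact: (@birkhoff_max_homo g (T w) n n.+1).
  - rewrite memNset; last by move=> /=; rewrite /pos /= ltNge Mle.
    by rewrite mulr0 subr_le0 (le_trans Mle)// birkhoff_max_ge0.
(* The cut-offs of g to the sets where the maximum is positive tend to g. *)
have cvh : \int[P]_w h n.+1 w @[n --> \oo] --> \int[P]_w g w.
  apply: (Rintegral_cvg_bounded (C := C)) => //; apply: aeW => w.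
  have [gw0|/gpos [k Sk]] := eqVneq (g w) 0.
    by rewrite /h gw0; under eq_fun do rewrite mul0r; exact: cvg_cst.
  apply: cvg_near_cst; exists k => // n /= kn; rewrite /h indicE mem_set ?mulr1//.
  apply: (lt_le_trans Sk); apply: le_trans (birkhoff_max_ge _ _ _) _.
  exact: birkhoff_max_homo (leqW kn).
rewrite -(cvg_lim _ cvh)//; apply: limr_ge => //; first exact: cvgP cvh.
exact: (nearW _ hge0).
Qed.

(** The set [E] where the Birkhoff sums of [f - e] are unbounded above is
    invariant, so [f] has nonpositive integral over it, while the maximal
    ergodic inequality gives [0 <= \int_E (f - e)].  Hence [e * P E <= 0]. *)
Lemma birkhoff_upper f C e : measurable_fun setT f -> (forall w, `|f w| <= C) ->
  0 < e -> (forall E, invariant_sets T E -> \int[P]_(w in E) f w <= 0) ->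
  {ae P, forall w, exists K : R, forall n, birkhoff_sum f n w <= e *+ n + K}.
Proof.
move=> mf fC e0 fE.
have C0 : 0 <= C by rewrite (le_trans _ (fC point)).
pose u w := f w - e.
have u_meas : measurable_fun setT u by exact: measurable_funB.
have uC w : `|u w| <= C + e.
  by rewrite (le_trans (ler_normB _ _))// lerD// gtr0_norm.
have Su n w : birkhoff_sum u n w = birkhoff_sum f n w - e *+ n.
  by rewrite /birkhoff_sum sumrB sumr_const card_ord.
pose E := \bigcap_k \bigcup_n [set w | k%:R < birkhoff_sum u n w].
have mE : measurable E.
  apply: bigcapT_measurable => k; apply: bigcupT_measurable => n.
  apply: measurable_ltr_set; first exact: measurable_cst.
  exact: measurable_birkhoff_sum.
have EP w : E w <-> forall K, exists n, K < birkhoff_sum u n w.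
  split=> [Ew K|Ew k _]; last by have [n] := Ew k%:R; exists n.
  have [n _ /= Kn] := Ew (Num.truncn `|K|).+1 I.
  exists n; apply: le_lt_trans Kn; rewrite (le_trans (ler_norm K))// ltW//.
  exact: truncnS_gt.
have TE : T @^-1` E = E.
  apply/seteqP; split => w /= /EP Ew; apply/EP => K.
    have [n Kn] := Ew (K - u w); exists n.+1.
    by rewrite birkhoff_sumS; lra.
  have [[|n]] := Ew (Num.max 0 (K + u w)).
    by rewrite /birkhoff_sum big_ord0 gt_max ltxx.
  by rewrite birkhoff_sumS gt_max => /andP[_ Kn]; exists n; lra.
have Tn w n : E w -> E (iter n T w).
  by elim: n => //= n IHn /IHn; rewrite -{1}TE.
have sumE n w : E w -> birkhoff_sum (u \_ E) n w = birkhoff_sum u n w.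
  by move=> Ew; apply: eq_bigr => i _; rewrite patchE mem_set //; exact: Tn.
have PE0 : P E = 0.
  have muE : measurable_fun setT (u \_ E).
    by apply/(measurable_restrictT u mE); exact: measurable_funS u_meas.
  have : 0 <= \int[P]_w (u \_ E) w.
    apply: (@maximal_ergodic _ (C + e)) => // w.
      rewrite patchE; case: ifP => // _; rewrite normr0; lra.
    rewrite patchE; case: ifPn; rewrite ?eqxx// inE => Ew _.
    by have [n Kn] := (EP w).1 Ew 0; exists n; rewrite sumE.
  rewrite -Rintegral_mkcond RintegralB //.
  - rewrite Rintegral_cst //.
    have := fE E (conj mE TE) => fE0 H.
    have : e * fine (P E) <= 0 by lra.
    rewrite pmulr_rle0// => PE; apply/eqP; rewrite eq_le measure_ge0 andbT.
    by rewrite -(@fineK _ (P E)) ?fin_num_measure// lee_fin.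
  - by apply: integrableS (bounded_integrable P mf fC).
  - apply: integrableS (bounded_integrable P (f := cst e) (C := e) _ _) => //.
    by move=> w; rewrite gtr0_norm.
exists E; split => // w /=; apply: contra_notP => nEw.
have [K nK] : exists K, ~ exists n, K < birkhoff_sum u n w.
  by apply/existsNP => H; apply: nEw; apply/EP.
exists K => n; rewrite leNgt; apply/negP => Kn; apply: nK; exists n.
by rewrite Su; lra.
Qed.

(** [birkhoff_upper] bounds the Birkhoff sums of [f - fbar] and of [fbar - f] by
    [e * n] plus a constant for each [e], and those of the invariant
    function [fbar] are [n * fbar]. *)
Theorem birkhoff_bounded (f fbar : Omega -> R) C :
  measurable_fun setT f -> measurable_fun setT fbar ->
  (forall w, `|f w| <= C) -> (forall w, `|fbar w| <= C) ->
  (forall w, fbar (T w) = fbar w) ->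
  (forall E, invariant_sets T E ->
    \int[P]_(w in E) f w = \int[P]_(w in E) fbar w) ->
  {ae P, forall w, n%:R^-1 * birkhoff_sum f n w @[n --> \oo] --> fbar w}.
Proof.
move=> mf mfb fC fbC fbT ffb.
have ib (g : Omega -> R) E : measurable E -> measurable_fun setT g ->
    (forall w, `|g w| <= C) -> P.-integrable E (EFin \o g).
  move=> mE mg gC; apply: integrableS (bounded_integrable P mg gC) => //.
have Sfb n w : birkhoff_sum fbar n w = fbar w *+ n.
  rewrite /birkhoff_sum -[RHS](@iter_addr_0 _ n) -big_const_ord.
  by apply: eq_bigr => i _; elim: (i : nat) => //= j <-.
have E0 (g h : Omega -> R) : measurable_fun setT g -> measurable_fun setT h ->
    (forall w, `|g w| <= C) -> (forall w, `|h w| <= C) ->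
    (forall E, invariant_sets T E ->
      \int[P]_(w in E) g w = \int[P]_(w in E) h w) ->
    forall k : nat, {ae P, forall w, exists K : R, forall n,
      birkhoff_sum (fun w => g w - h w) n w <= k.+1%:R^-1 *+ n + K}.
  move=> mg mh gC hC gh k; apply: (@birkhoff_upper _ (C + C)).
  - exact: measurable_funB.
  - by move=> w; rewrite (le_trans (ler_normB _ _))// lerD.
  - by rewrite invr_gt0.
  - by move=> E [mE TE]; rewrite RintegralB ?gh ?subrr//; exact: ib.
have := ae_foralln (E0 _ _ mf mfb fC fbC ffb).
have := ae_foralln (E0 _ _ mfb mf fbC fC (fun E iE => esym (ffb E iE))).
apply: filterS2 => w lo up; apply/cvgrPdist_le => /= e e0.
have [k ke] : exists k : nat, k.+1%:R^-1 <= e / 2.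
  exists (Num.truncn (e / 2)^-1); rewrite invf_ple ?posrE ?divr_gt0//.
  by rewrite ltW// truncnS_gt.
have [K1 {}lo] := lo k; have [K2 {}up] := up k.
pose K : R := Num.max `|K1| `|K2|.
have K1K : K1 <= K by rewrite (le_trans (ler_norm _))// le_max lexx.
have K2K : K2 <= K by rewrite (le_trans (ler_norm _))// le_max lexx orbT.
clearbody K.
have Ke : \forall n \near \oo, K <= (e / 2) *+ n.
  exists (Num.truncn (K / (e / 2))).+1 => // n /= kn.
  rewrite -mulr_natr mulrC -ler_pdivrMr ?divr_gt0//.
  by rewrite ltW// (lt_le_trans (truncnS_gt _))// ler_nat.
near=> n.
have n0 : (0 < n%:R :> R) by rewrite ltr0n; near: n; exists 1%N.
rewrite -(ler_pM2l n0) -[X in X * `|_|]gtr0_norm// -normrM mulrBr mulVKf ?gt_eqF//.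
have S n' : birkhoff_sum (fun w => f w - fbar w) n' w =
    birkhoff_sum f n' w - n'%:R * fbar w.
  by rewrite /birkhoff_sum sumrB -[\sum_(i < n') fbar _]/(birkhoff_sum fbar n' w)
    Sfb mulr_natl.
have S' n' : birkhoff_sum (fun w => fbar w - f w) n' w =
    n'%:R * fbar w - birkhoff_sum f n' w.
  by rewrite /birkhoff_sum sumrB -[\sum_(i < n') fbar _]/(birkhoff_sum fbar n' w)
    Sfb mulr_natl.
have := lo n; rewrite S' => lon; have := up n; rewrite S => upn.
have k2 : k.+1%:R^-1 *+ n <= (e / 2) *+ n by rewrite lerMn2r ke orbT.
have Kn : K <= (e / 2) *+ n by near: n.
have en : (e / 2) *+ n + (e / 2) *+ n = n%:R * e.
  by rewrite -mulrnDl -splitr mulr_natl.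
rewrite -en ler_norml; move: lon upn k2 Kn {en}.
move: (e / 2 *+ n) (_ *+ n) (_ * fbar w) (birkhoff_sum f n w) => a b c s.
by move=> *; apply/andP; split; lra.
Unshelve. all: by end_near. Qed.

End birkhoff.

(** * Empirical frequencies of a stationary sequence *)

Section empirical.
Context (d : measure_display) (Omega : measurableType d) (R : realType)
  (P : probability Omega R) (T : Omega -> Omega)
  (d' : measure_display) (S : measurableType d')
  (X0 : Omega -> S) (mu : Omega -> probability S R).
Hypothesis T_mp : measure_preserving P T.
Hypothesis mX0 : measurable_fun setT X0.
Hypothesis mu_cond : is_regular_cond_distribution P (invariant_sets T) X0 mu.

Let mT : measurable_fun setT T. Proof. by case: T_mp. Qed.

Lemma sigma_algebra_invariant : sigma_algebra setT (invariant_sets T).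
Proof.
split.
- by split => //; rewrite preimage_set0.
- move=> E [mE TE]; split; first by rewrite setTD; exact: measurableC.
  by rewrite setTD -preimage_setC TE.
- move=> E iE; split; first by apply: bigcupT_measurable => i; case: (iE i).
  by rewrite preimage_bigcup; apply: eq_bigcupr => i _; case: (iE i).
Qed.

Lemma cond_distribution_measurable (A : set S) : measurable A ->
  measurable_fun setT (fun w => mu w A).
Proof. by move=> mA; have [_ /integrableP[]] := mu_cond mA. Qed.

(** The level sets of [mu ^~ A] belong to the sigma-algebra generated by the
    invariant sets, which consists of invariant sets only. *)
Lemma cond_distribution_invariant (A : set S) w : measurable A ->
  mu (T w) A = mu w A.
Proof.
move=> mA; have [mmu _ _] := mu_cond mA.
have := mmu measurableT [set mu w A] (emeasurable_set1 _).
rewrite setTI /measurable /= (sigma_algebra_id sigma_algebra_invariant).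
case=> _ E; suff : (T @^-1` ((mu ^~ A) @^-1` [set mu w A])) w by [].
by rewrite E.
Qed.

Lemma prob_fine_bound (nu : probability S R) A : measurable A ->
  `|fine (nu A)| <= 1.
Proof.
move=> mA; rewrite ger0_norm ?fine_ge0//.
by rewrite -lee_fin fineK ?fin_num_measure// probability_le1.
Qed.

(** The sample starts at index [1], so the ergodic theorem is applied to the
    indicator of [X_0 \o T \in A]. *)
Lemma empirical_cvg (A : set S) : measurable A ->
  {ae P, forall w, n%:R^-1 * \sum_(i < n) \1_A (X0 (iter i.+1 T w))
     @[n --> \oo] --> fine (mu w A)}.
Proof.
move=> mA.
have mXT : measurable_fun setT (X0 \o T) by exact: measurableT_comp.
have mI : measurable_fun setT ((\1_A : S -> R) \o (X0 \o T)).
  by apply: measurableT_comp => //; exact: measurable_indic.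
have mI0 : measurable_fun setT ((\1_A : S -> R) \o X0).
  by apply: measurableT_comp => //; exact: measurable_indic.
apply: (birkhoff_bounded T_mp (f := fun w => \1_A (X0 (T w)))
  (fbar := fun w => fine (mu w A)) (C := 1)) => //.
- by apply: measurableT_comp => //; exact: cond_distribution_measurable.
- by move=> w; rewrite indicE; case: (_ \in _); rewrite ?normr1 ?normr0.
- by move=> w; exact: prob_fine_bound.
- by move=> w; rewrite cond_distribution_invariant.
move=> E [mE TE]; rewrite /Rintegral; congr fine.
transitivity (\int[P]_(w in E) (\1_(X0 @^-1` A) w)%:E)%E; last first.
  have [_ _ <- //] := mu_cond mA; apply: eq_integral => w _.
  by rewrite fineK ?fin_num_measure.
rewrite integral_mkcond [RHS]integral_mkcond.
rewrite -(integral_measure_preserving T_mp (f := (fun w => (\1_(X0 @^-1` A) w)%:E) \_ E)).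
  apply: eq_integral => w _; rewrite !patchE.
  have -> : (w \in E) = (T w \in E).
    by rewrite -{1}TE; apply/idP/idP; rewrite !inE.
  by rewrite !indicE; congr (if _ then (_%:R)%:E else _); apply/idP/idP; rewrite !inE.
apply/(measurable_restrictT _ mE); apply: measurable_funTS.
by apply/measurable_EFinP; exact: mI0.
Qed.

End empirical.

(** * Product measures *)

Section power_prob_theory.
Context (d : measure_display) (S : measurableType d) (R : realType).

Lemma measurable_box (m : nat) (A : 'I_m -> set S) :
  (forall j, measurable (A j)) ->
  measurable [set t : m.-tuple S | forall j, A j (tnth t j)].
Proof.
move=> mA; rewrite (_ : mkset _ = \bigcap_j ((fun t => tnth t j) @^-1` A j)).
  apply: fin_bigcap_measurable => // j _; rewrite -[X in measurable X]setTI.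
  exact: measurable_tnth.
by apply/seteqP; split => t /= H j *; exact: H.
Qed.

Lemma power_prob_box (nu : probability S R) (m : nat) (A : 'I_m -> set S) :
  (forall j, measurable (A j)) ->
  power_prob nu m [set t | forall j, A j (tnth t j)] =
  (\prod_(j < m) nu (A j))%E.
Proof.
elim: m A => [|m IHm] A mA.
  rewrite big_ord0 /= diracE mem_set//; by case.
rewrite big_ord_recl -IHm//.
have mbox : measurable [set t : m.-tuple S | forall j, A (lift ord0 j) (tnth t j)].
  exact: (@measurable_box _ (fun j => A (lift ord0 j))).
rewrite -[RHS](product_measure1E nu (power_prob nu m) (mA ord0) mbox).
rewrite /= /distribution /pushforward; congr (_ _).
apply/seteqP; split => -[x t] /=.
  move=> H; split; first exact: (H ord0).
  by move=> j; have := H (lift ord0 j); rewrite tnthS.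
move=> [A0 H] j; have [k ->|->//] := unliftP ord0 j.
by rewrite tnthS.
Qed.

(** Measurability of products of random measures: the product of two
    subprobabilities is a measurable operation for the Giry sigma-algebra. *)
Lemma measurable_power_prob (d' : measure_display) (Omega : measurableType d')
    (mu : Omega -> probability S R) (m : nat) (A : set (m.-tuple S)) :
  (forall B, measurable B -> measurable_fun setT (fun w => mu w B)) ->
  measurable A -> measurable_fun setT (fun w => power_prob (mu w) m A).
Proof.
move=> mmu; elim: m A => [|m IHm] A mA; first exact: measurable_cst.
have mm : measurable_fun setT (fun w => mu w : giry S R).
  exact: measurable_giry_codensity.
have mp : measurable_fun setT (fun w => power_prob (mu w) m : giry _ R).
  by apply: measurable_giry_codensity => // B mB; exact: IHm.
have mq : measurable_fun setT (fun w => giry_prod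
    (mu w : giry S R, power_prob (mu w) m : giry _ R)).
  by apply: measurableT_comp measurable_giry_prod _; exact: measurable_fun_pair.
have mA' : measurable (@tcons _ S m @^-1` A).
  rewrite -[X in measurable X]setTI; exact: measurable_tcons.
exact: (measurableT_comp (measurable_giry_ev mA') mq).
Qed.

Lemma measurable_multi_integral (d' : measure_display)
    (Omega : measurableType d') (mu : Omega -> probability S R) (m : nat)
    (g : m.-tuple S -> R) :
  (forall B, measurable B -> measurable_fun setT (fun w => mu w B)) ->
  measurable_fun setT g -> measurable_fun setT (fun w => multi_integral (mu w) g).
Proof.
move=> mmu mg; rewrite /multi_integral; under eq_fun do rewrite integralE.
have mk (k : m.-tuple S -> \bar R) : measurable_fun setT k ->
    (forall x, 0 <= k x)%E ->
    measurable_fun setT (fun w => \int[power_prob (mu w) m]_x k x)%E.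
  move=> mk k0; apply: (measurable_fun_integral_kernel
    (l := fun w => power_prob (mu w) m)) => // U mU.
  exact: measurable_power_prob.
have mg' : measurable_fun setT (EFin \o g) by exact/measurable_EFinP.
apply: emeasurable_funB; apply: mk => //.
  exact: (measurable_funepos mg').
exact: (measurable_funeneg mg').
Qed.

End power_prob_theory.

(** * Kernels that depend on finitely many values *)

Section finite_code.
Context (d : measure_display) (S : measurableType d) (R : realType)
  (I : finType) (c : S -> I).
Hypothesis mc : forall i, measurable (c @^-1` [set i]).

Definition code_fun (m : nat) (Phi : m.-tuple I -> R) (t : m.-tuple S) : R :=
  Phi [tuple of map c t].

(** A code function is a combination of products of indicators of cells; both
    its averages and its integrals are read off this expression. *)
Lemma code_funE (m : nat) (Phi : m.-tuple I -> R) t :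
  code_fun Phi t =
  \sum_(a : m.-tuple I) Phi a * \prod_(j < m) \1_(c @^-1` [set tnth a j]) (tnth t j).
Proof.
rewrite (bigD1 [tuple of map c t])//= [X in _ * X + _]big1; last first.
  by move=> j _; rewrite indicE mem_set //= tnth_map.
rewrite mulr1 big1 ?addr0//= => a ac.
have [j aj] : exists j, tnth a j != c (tnth t j).
  apply/existsP; apply: contraNT ac => /existsPn H; apply/eqP/eq_from_tnth => j.
  by rewrite tnth_map; apply/eqP; have := H j; rewrite negbK.
rewrite (bigD1 j)//= indicE memNset ?mul0r ?mulr0// => /= cj.
by rewrite cj eqxx in aj.
Qed.

Let box (m : nat) (a : m.-tuple I) : set (m.-tuple S) :=
  [set t | forall j, (c @^-1` [set tnth a j]) (tnth t j)].

Let code_funE' (m : nat) (Phi : m.-tuple I -> R) t :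
  code_fun Phi t = \sum_(a : m.-tuple I) Phi a * \1_(box a) t.
Proof.
rewrite code_funE; apply: eq_bigr => a _; congr (_ * _).
rewrite indicE; have [/set_mem H|/negP H] := boolP (t \in box a).
  by rewrite big1// => j _; rewrite indicE mem_set //; exact: H.
have [j Hj] : exists j, c (tnth t j) <> tnth a j.
  by apply/existsNP => H'; apply: H; apply/mem_set.
by rewrite (bigD1 j)//= indicE memNset ?mul0r.
Qed.

Lemma measurable_code_fun (m : nat) (Phi : m.-tuple I -> R) :
  measurable_fun setT (code_fun Phi).
Proof.
rewrite (_ : code_fun Phi = fun t => \sum_(a : m.-tuple I) Phi a * \1_(box a) t).
  apply: measurable_sum => a; apply: measurable_funM => //.
  apply: measurable_indic.
  exact: (@measurable_box _ _ _ (fun j => c @^-1` [set tnth a j])).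
by apply/funext => t; rewrite code_funE'.
Qed.

Lemma Rintegral_code_fun (nu : probability S R) (m : nat) (Phi : m.-tuple I -> R) :
  \int[power_prob nu m]_t code_fun Phi t =
  \sum_(a : m.-tuple I) Phi a * \prod_(j < m) fine (nu (c @^-1` [set tnth a j])).
Proof.
have mbox a : measurable (@box m a).
  exact: (@measurable_box _ _ _ (fun j => c @^-1` [set tnth a j])).
have ibox a : (power_prob nu m).-integrable setT (fun t => (Phi a * \1_(box a) t)%:E).
  apply: (bounded_integrable _ (C := `|Phi a|)).
    by apply: measurable_funM => //; exact: measurable_indic.
  move=> t; rewrite normrM ler_piMr// indicE.
  by case: (_ \in _); rewrite ?normr1 ?normr0.
rewrite /Rintegral; under eq_integral do rewrite code_funE' -sumEFin.
rewrite integral_sum //.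
rewrite -[RHS]/(fine (_)%:E); congr fine; rewrite -sumEFin.
apply: eq_bigr => a _; under eq_integral do rewrite EFinM.
rewrite integralZl//.
  rewrite integral_indic// setIT EFinM; congr (_ * _)%E.
  have := @power_prob_box _ _ _ nu _ (fun j => c @^-1` [set tnth a j])
    (fun j => mc (tnth a j)).
  rewrite -/(box a) => H; apply: (etrans H).
  rewrite -prodEFin; apply: eq_bigr => j _; rewrite fineK//.
  by apply: fin_num_measure; exact: mc.
apply: (bounded_integrable _ (C := 1)); first exact: measurable_indic.
by move=> t; rewrite indicE; case: (_ \in _); rewrite ?normr1 ?normr0.
Qed.

(** The average over all index tuples of a product of functions of the single
    coordinates is the product of their averages. *)
Lemma Vstat_code_fun (m n : nat) (Phi : m.-tuple I -> R) (x : 'I_n -> S) :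
  (n%:R ^+ m)^-1 * \sum_(i : m.-tuple 'I_n) code_fun Phi [tuple of map x i] =
  \sum_(a : m.-tuple I) Phi a *
    \prod_(j < m) (n%:R^-1 * \sum_(i < n) \1_(c @^-1` [set tnth a j]) (x i)).
Proof.
under eq_bigr do rewrite code_funE.
rewrite exchange_big mulr_sumr; apply: eq_bigr => a _ /=.
rewrite -mulr_sumr mulrCA; congr (_ * _).
rewrite big_split /= prodr_const card_ord exprVn; congr (_ * _).
rewrite bigA_distr_bigA /=.
rewrite (reindex (fun f : {ffun 'I_m -> 'I_n} => [tuple f j | j < m])) /=.
  apply: eq_bigr => f _; apply: eq_bigr => j _.
  by rewrite tnth_map tnth_mktuple.
exists (fun t : m.-tuple 'I_n => [ffun j => tnth t j]) => t _.
  by apply/ffunP => j; rewrite ffunE tnth_mktuple.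
by apply: eq_from_tnth => j; rewrite tnth_mktuple ffunE.
Qed.

Lemma Vstat_code_cvg (nu : probability S R) (m : nat) (Phi : m.-tuple I -> R)
    (x : nat -> S) :
  (forall i, n%:R^-1 * \sum_(k < n) \1_(c @^-1` [set i]) (x k) @[n --> \oo]
     --> fine (nu (c @^-1` [set i]))) ->
  (n%:R ^+ m)^-1 *
    \sum_(i : m.-tuple 'I_n) code_fun Phi [tuple of map (fun k : 'I_n => x k) i]
    @[n --> \oo] --> \int[power_prob nu m]_t code_fun Phi t.
Proof.
move=> cvx; rewrite Rintegral_code_fun.
under eq_fun do rewrite Vstat_code_fun.
apply: cvg_big => [|a _]; first exact: add_continuous.
apply: cvgM; first exact: cvg_cst.
by apply: cvg_big => [|j _]; [exact: mul_continuous|exact: cvx].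
Qed.

End finite_code.

(** * Null sets that need not be measurable *)

Section inner_measure.
Context (d : measure_display) (S : measurableType d) (R : realType).
Import HBNNSimple.

(** The integral of a nonnegative function is the supremum over the simple
    functions below it, hence monotone without measurability. *)
Lemma le_lower_integral (nu : {measure set S -> \bar R}) (f g : S -> \bar R) :
  (forall x, 0 <= f x)%E -> (forall x, f x <= g x)%E ->
  (\int[nu]_x f x <= \int[nu]_x g x)%E.
Proof.
move=> f0 fg; rewrite !ge0_integralTE// => [|x]; last exact: le_trans (fg x).
apply: ereal_sup_le => _ [k /= kf <-]; exists k => // x.
exact: le_trans (fg x).
Qed.

(** This is how the assumption on the discontinuity set is used: it forces
    every measurable subset of that set to be null. *)
Lemma null_indic_subset (nu : probability S R) (D E : set S) :
  (\int[nu]_x (\1_D x)%:E = 0)%E -> measurable E -> E `<=` D -> nu E = 0%E.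
Proof.
move=> D0 mE ED; apply/eqP; rewrite eq_le measure_ge0 andbT -D0.
rewrite -[E in leLHS]setIT -integral_indic//; apply: le_lower_integral => x.
  by rewrite lee_fin.
rewrite lee_fin !indicE ler_nat.
by case: (boolP (x \in E)) => // /set_mem/ED xD; rewrite mem_set.
Qed.

End inner_measure.

(** * Cells of a countable base *)

Section countable_base.
Context (R : realType) (S : pmetricType R).

Lemma separable_base : (exists2 D : set S, countable D & dense D) ->
  exists B : nat -> set S, (forall k, open (B k)) /\
    forall x (U : set S), nbhs x U -> exists k, B k x /\ B k `<=` U.
Proof.
move=> [D cD dD].
have [x_ x_D] : exists x_ : nat -> S, D `<=` range x_.
  move/pfcard_geP : cD => [->|[f]]; first by exists (fun=> point).
  exists f => y Dy; have [n _ <-] := @surj _ _ _ _ f y Dy; by exists n.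
pose B k := if unpickle k is Some (i, j) then (ball (x_ i) (j.+1%:R^-1 : R))^°
            else setT.
exists B; split => [k|x U].
  rewrite /B; case: unpickle => [[i j]|]; last exact: openT.
  exact: open_interior.
move=> /nbhs_ballP[e /= e0 xeU].
have [j je] : exists j : nat, j.+1%:R^-1 <= e / 2.
  exists (Num.truncn (e / 2)^-1); rewrite invf_ple ?posrE ?divr_gt0//.
  by rewrite ltW// truncnS_gt.
pose r : R := j.+1%:R^-1; have r0 : 0 < r by rewrite invr_gt0.
have [y [xy /x_D[i _ iy]]] : (ball x (r / 2))^° `&` D !=set0.
  apply: dD; last exact: open_interior.
  by exists x; apply: nbhsx_ballx; rewrite divr_gt0.
have {}xy : ball x (r / 2) y by apply: interior_subset xy.
exists (pickle (i, j)); rewrite /B pickleK iy; split.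
  apply: (@filterS _ _ _ (ball x (r / 2))); last by apply: nbhsx_ballx; rewrite divr_gt0.
  move=> z xz; have := ball_triangle (ball_sym xy) xz; by rewrite -splitr.
move=> z /interior_subset yz; apply: xeU.
apply: le_ball (ball_triangle xy yz); rewrite -/r in je *; lra.
Qed.

End countable_base.

Section codes.
Context (R : realType) (S : pmetricType R) (B : nat -> set S).
Hypothesis openB : forall k, open (B k).

Definition base_code (N : nat) (x : borel S) : {ffun 'I_N -> bool} :=
  [ffun k : 'I_N => `[< B k x >]].

Lemma measurable_base_code N i : measurable (base_code N @^-1` [set i]).
Proof.
rewrite (_ : _ @^-1` _ = \bigcap_(k : 'I_N) if i k then B k else ~` B k).
  apply: fin_bigcap_measurable => // k _.
  have mB : measurable (B k : set (borel S)) by apply: sub_sigma_algebra; exact: openB.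
  by case: (i k) => //; exact: measurableC.
apply/seteqP; split => [x /= <- k _|x /= xB].
  by rewrite ffunE; case: asboolP.
apply/ffunP => k; rewrite ffunE; have := xB k I.
by case: (i k) => [|] H; [exact/asboolP|exact/asboolPn].
Qed.

Lemma base_code_agree N (x y : borel S) k :
  base_code N x = base_code N y -> (k < N)%N -> B k y -> B k x.
Proof.
move=> xy kN; have /(congr1 (fun f : {ffun 'I_N -> bool} => f (Ordinal kN))) := xy.
by rewrite !ffunE /= => E By; apply/asboolP; rewrite E; exact/asboolP.
Qed.

Hypothesis baseB :
  forall x (U : set S), nbhs x U -> exists k, B k x /\ B k `<=` U.

(** The cells around [t] generate a filter that converges to [t] in the product
    topology, although cells need not be neighbourhoods of [t]. *)
Lemma base_code_continuous (m : nat) (h : m.-tuple (borel S) -> R)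
    (t : m.-tuple (borel S)) (e : R) :
  0 < e ->
  ~ discontinuity_set (h : m.-tuple S -> R) t ->
  exists N0, forall N, (N0 <= N)%N -> forall y : m.-tuple (borel S),
    [tuple of map (base_code N) y] = [tuple of map (base_code N) t] -> `|h t - h y| <= e.
Proof.
move=> e0 /contrapT ct.
pose cell N : set {ptws 'I_m -> S} :=
  [set x | forall j, base_code N (x j) = base_code N (tnth t j)].
have cell_mono N1 N2 : (N1 <= N2)%N -> cell N2 `<=` cell N1.
  move=> N12 x xc j; apply/ffunP => k.
  have := congr1 (fun f : {ffun 'I_N2 -> bool} => f (widen_ord N12 k)) (xc j).
  by rewrite !ffunE.
pose F := filter_from setT cell.
have FF : Filter F.
  apply: filter_from_filter; first by exists 0%N.
  move=> N1 N2 _ _; exists (maxn N1 N2) => // x xc.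
  by split; apply: cell_mono xc; rewrite ?leq_maxl ?leq_maxr.
have cvF : F --> (tnth t : {ptws 'I_m -> S}).
  apply/cvg_sup => j; apply/cvg_image.
    by rewrite eqEsubset; split=> v // _; exists (fun=> v).
  move=> U /baseB[k [Bk kU]].
  exists ((fun x : {ptws 'I_m -> S} => x j) @^-1` U); last first.
    by rewrite image_preimage// eqEsubset; split=> v // _; exists (fun=> v).
  by exists k.+1 => // x xc; apply: kU; exact: (base_code_agree (xc j)).
have := cvF _ (ct _ (nbhsx_ballx _ _ e0)).
have tE : [tuple tnth t j | j < m] = t by apply: eq_from_tnth => j; rewrite tnth_mktuple.
move=> [N0 _ N0e]; exists N0 => N NN y yt.
have : cell N0 (tnth y).
  apply: (cell_mono _ _ NN) => j.
  by rewrite -(tnth_map (base_code N)) yt tnth_map.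
move=> /N0e /=; rewrite tE /ball /=.
rewrite (_ : [tuple tnth y j | j < m] = y); first exact: ltW.
by apply: eq_from_tnth => j; rewrite tnth_mktuple.
Qed.

End codes.

(** * Averages of bounded kernels over all tuples *)

Section Vstat.
Context (R : realType) (S : pmetricType R) (B : nat -> set S).
Hypothesis openB : forall k, open (B k).
Hypothesis baseB :
  forall x (U : set S), nbhs x U -> exists k, B k x /\ B k `<=` U.
Context (m : nat) (h : m.-tuple (borel S) -> R) (K : R).
Hypothesis mh : measurable_fun setT h.
Hypothesis hK : forall t, `|h t| <= K.

Let codeT N (t : m.-tuple (borel S)) := [tuple of map (base_code B N) t].
Let cell N a := [set t | codeT N t = a].
Arguments cell : clear implicits.
(* The default point serves for empty cells only. *)
Let rep N a : m.-tuple (borel S) := xget point (cell N a).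
Arguments rep : clear implicits.
Let Phi N a := h (rep N a).
Arguments Phi : clear implicits.
(* The oscillation of h around its value at the representative. *)
Let rho N a := sup [set `|h y - Phi N a| | y in cell N a].
Arguments rho : clear implicits.

Let mcode N i : measurable (base_code B N @^-1` [set i] : set (borel S)).
Proof. exact: measurable_base_code. Qed.

Let hPhi N a y : `|h y - Phi N a| <= K + K.
Proof. by rewrite (le_trans (ler_normB _ _))// lerD ?hK. Qed.

Let rho_ge N y : `|h y - Phi N (codeT N y)| <= rho N (codeT N y).
Proof.
apply: ub_le_sup; last by exists y.
by exists (K + K) => _ [z _ <-].
Qed.

Let rho_le N y e : (forall z, cell N (codeT N y) z ->
  `|h z - Phi N (codeT N y)| <= e) -> rho N (codeT N y) <= e.
Proof.
move=> He; apply: ge_sup; last by move=> _ [z cz <-]; exact: He.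
by exists `|h y - Phi N (codeT N y)|; exists y.
Qed.

Let rho_bound N y : `|rho N (codeT N y)| <= K + K.
Proof.
rewrite ger0_norm; first by apply: rho_le => z _; exact: hPhi.
by rewrite (le_trans _ (rho_ge N y)).
Qed.

Let rho_continuous t (e : R) : 0 < e -> ~ discontinuity_set (h : m.-tuple S -> R) t ->
  exists N0, forall N, (N0 <= N)%N -> rho N (codeT N t) <= e.
Proof.
move=> e0 ct; have e2 : 0 < e / 2 by rewrite divr_gt0.
have [N0 HN0] := base_code_continuous baseB e2 ct; exists N0 => N NN.
apply: rho_le => z cz.
have cr : cell N (codeT N t) (rep N (codeT N t)) by apply: (@xgetI _ _ _ t).
have := HN0 _ NN _ cz; have := HN0 _ NN _ cr.
rewrite -/(Phi N (codeT N t)) => H1 H2.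
rewrite (splitr e) -(subrK (h t) (h z)) -addrA.
by rewrite (le_trans (ler_normD _ _))// lerD// distrC.
Qed.

Let mPhi N : measurable_fun setT (code_fun (base_code B N) (Phi N)).
Proof. exact: (measurable_code_fun (@mcode N)). Qed.

Let mrho N : measurable_fun setT (code_fun (base_code B N) (rho N)).
Proof. exact: (measurable_code_fun (@mcode N)). Qed.

Variable nu : probability (borel S) R.
Hypothesis nuD : multi_integral nu
  (\1_(discontinuity_set (h : m.-tuple S -> R)) : m.-tuple (borel S) -> R) = 0%E.

(** The set where the oscillation does not tend to [0] is measurable and consists
    of discontinuity points, hence is null. *)
Lemma oscillation_cvg0 : \int[power_prob nu m]_t code_fun (base_code B N) (rho N) t
  @[N --> \oo] --> (0 : R).
Proof.
have -> : (0 : R) = \int[power_prob nu m]_t (fun=> 0 : R) t.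
  by rewrite Rintegral_cst// mul0r.
apply: (Rintegral_cvg_bounded (C := K + K)) => //.
pose E := \bigcup_k \bigcap_M \bigcup_(N in [set N | (M <= N)%N])
  [set t | k.+1%:R^-1 < code_fun (base_code B N) (rho N) t].
have mE : measurable E.
  apply: bigcupT_measurable => k; apply: bigcapT_measurable => M.
  apply: bigcup_measurable => N _; apply: measurable_ltr_set => //.
exists E; split => //.
  apply: null_indic_subset nuD mE _ => t [k _ kt]; apply: contrapT => ct.
  have k0 : 0 < k.+1%:R^-1 :> R by rewrite invr_gt0.
  have [N0 HN0] := rho_continuous k0 ct.
  by have [N /= NN] := kt N0 I; rewrite ltNge HN0.
move=> t /=; apply: contra_notP => nE; apply/cvgrPdist_le => /= e e0.
pose k := Num.truncn e^-1.
have ke : k.+1%:R^-1 <= e by rewrite invf_ple ?posrE// ltW// truncnS_gt.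
have [M HM] : exists M, forall N, (M <= N)%N ->
    code_fun (base_code B N) (rho N) t <= k.+1%:R^-1.
  apply: contrapT => H; apply: nE; exists k => // M _.
  apply: contrapT => H'; apply: H; exists M => N MN.
  rewrite leNgt; apply/negP => lt; apply: H'; by exists N.
exists M => // N /= MN; rewrite sub0r normrN (le_trans _ ke)//.
rewrite ger0_norm ?HM//; exact: le_trans (rho_ge N t).
Qed.

(** Replacing [h] by its value at the representative costs at most the average,
    respectively the integral, of the oscillation, which is itself a
    function of the codes. *)
Theorem Vstat_cvg (x : nat -> borel S) :
  (forall N i, n%:R^-1 * \sum_(k < n) \1_(base_code B N @^-1` [set i]) (x k)
     @[n --> \oo] --> fine (nu (base_code B N @^-1` [set i]))) ->
  (n%:R ^+ m)^-1 *
    \sum_(i : m.-tuple 'I_n) h [tuple of map (fun k : 'I_n => x k) i]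
    @[n --> \oo] --> \int[power_prob nu m]_t h t.
Proof.
move=> cvx; apply/cvgrPdist_le => /= e e0.
have e4 : 0 < e / 4 by rewrite divr_gt0.
have /cvgrPdist_le/(_ _ e4)[N _ /(_ N (leqnn N))] := oscillation_cvg0.
rewrite sub0r normrN => rhoN.
have cvPhi := Vstat_code_cvg (@mcode N) (Phi := Phi N) (cvx N).
have cvrho := Vstat_code_cvg (@mcode N) (Phi := rho N) (cvx N).
move/cvgrPdist_le : cvPhi => /(_ _ e4) cvPhi.
move/cvgrPdist_le : cvrho => /(_ _ e4) cvrho.
have ih : (power_prob nu m).-integrable setT (EFin \o h).
  exact: bounded_integrable mh hK.
have iPhi : (power_prob nu m).-integrable setT (EFin \o code_fun (base_code B N) (Phi N)).
  by apply: (bounded_integrable _ (C := K)) => // t; exact: hK.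
have irho : (power_prob nu m).-integrable setT (EFin \o code_fun (base_code B N) (rho N)).
  by apply: (bounded_integrable _ (C := K + K)) => // t; exact: rho_bound.
have intle : `|\int[power_prob nu m]_t h t -
     \int[power_prob nu m]_t code_fun (base_code B N) (Phi N) t| <= e / 4.
  rewrite -RintegralB//; apply: le_trans (le_normr_Rintegral _ _) _ => //.
    by apply: (bounded_integrable _ (C := K + K)) => [|t];
      [exact: measurable_funB|exact: hPhi].
  apply: le_trans rhoN; apply: le_trans (ler_norm _).
  apply: le_Rintegral => //; last by move=> t _; exact: rho_ge.
  apply: (bounded_integrable _ (C := K + K)) => [|t].
    by apply: measurableT_comp => //; exact: measurable_funB.
  by rewrite normr_id; exact: hPhi.
near=> n.
set V := (V in _ - V).
pose VPhi := (n%:R ^+ m)^-1 * \sum_(i : m.-tuple 'I_n)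
  code_fun (base_code B N) (Phi N) [tuple of map (fun k : 'I_n => x k) i].
pose Vrho := (n%:R ^+ m)^-1 * \sum_(i : m.-tuple 'I_n)
  code_fun (base_code B N) (rho N) [tuple of map (fun k : 'I_n => x k) i].
have VV : `|VPhi - V| <= Vrho.
  rewrite distrC /V /VPhi /Vrho -mulrBr normrM ger0_norm ?invr_ge0 ?exprn_ge0//.
  rewrite ler_wpM2l ?invr_ge0 ?exprn_ge0// -sumrB.
  apply: le_trans (ler_norm_sum _ _ _) _; apply: ler_sum => i _; exact: rho_ge.
have : `|\int[power_prob nu m]_t code_fun (base_code B N) (Phi N) t - VPhi| <= e / 4.
  by rewrite /VPhi; near: n.
have : `|\int[power_prob nu m]_t code_fun (base_code B N) (rho N) t - Vrho| <= e / 4.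
  by rewrite /Vrho; near: n.
move: rhoN intle VV; rewrite !ler_norml; clearbody V VPhi Vrho.
move=> /andP[? ?] /andP[? ?] /andP[? ?] /andP[? ?] /andP[? ?].
by apply/andP; split; lra.
Unshelve. all: by end_near. Qed.

End Vstat.

(** * From all tuples to increasing tuples *)

Section ordered_tuples.
Context (R : realType) (m n : nat).
Implicit Types (F : m.-tuple 'I_n -> R) (s t : m.-tuple 'I_n).

Lemma card_perm_eq_tuple s : uniq s ->
  #|[pred t : m.-tuple 'I_n | perm_eq s t]| = m`!.
Proof.
move=> us; rewrite -[m in RHS](size_tuple s) -ffactnn -{1}(card_uniqP us).
rewrite (size_tuple s) -(card_uniq_tuples m (mem s)) cardsE.
apply: eq_card => t; rewrite !inE; apply/idP/andP => [st|[/allP ts ut]].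
  split; last by rewrite -(perm_uniq st).
  by apply/allP => x; rewrite -(perm_mem st).
apply: uniq_perm => //; have := uniq_min_size ut ts.
by rewrite !size_tuple => /(_ (leqnn _))[_ E] x; rewrite E.
Qed.

(** Sorting maps the tuples without repetition onto the increasing ones, and the
    [m!] rearrangements of an increasing tuple form one fibre. *)
Lemma sum_uniq_sorted F : (forall s t, perm_eq s t -> F s = F t) ->
  \sum_(t : m.-tuple 'I_n | uniq t) F t =
  (m`!)%:R * \sum_(t : m.-tuple 'I_n | sorted ltn (map val t)) F t.
Proof.
move=> symF; pose le := relpre (@nat_of_ord n) leq.
have le_total : total le by move=> x y; exact: leq_total.
have le_trans : transitive le by move=> x y z; exact: leq_trans.
have le_anti : antisymmetric le.
  by move=> x y xy; apply/val_inj/anti_leq.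
have sortedE t : sorted ltn (map val t) = uniq t && sorted le t.
  by rewrite ltn_sorted_uniq_leq (map_inj_uniq val_inj) sorted_map.
rewrite (partition_big (fun t => [tuple of sort le t])
   (fun t => sorted ltn (map val t))) /=; last first.
  by move=> t ut; rewrite sortedE sort_uniq ut sort_sorted.
rewrite mulr_sumr; apply: eq_bigr => s; rewrite sortedE => /andP[us ss].
transitivity (\sum_(t : m.-tuple 'I_n | perm_eq s t) F s); last first.
  by rewrite sumr_const card_perm_eq_tuple // mulr_natl.
apply: eq_big => [t|t /andP[ut /eqP <-]]; last first.
  by apply: symF; rewrite perm_sym /= perm_sort.
apply/andP/idP => [[ut /eqP <-]|st]; first by rewrite /= perm_sort.
split; first by rewrite -(perm_uniq st).
apply/eqP/val_inj => /=; apply: (sorted_eq le_trans le_anti) => //.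
  exact: sort_sorted.
by rewrite perm_sort perm_sym.
Qed.

End ordered_tuples.

Lemma card_uniq_tuple_ord (m n : nat) :
  #|[pred t : m.-tuple 'I_n | uniq t]| = (n ^_ m)%N.
Proof.
rewrite -[in RHS](card_ord n) -card_uniq_tuples cardsE.
apply: eq_card => i; rewrite !inE unfold_in /=.
by rewrite (_ : all _ i = true) //; apply/allP.
Qed.

Lemma symmetric_kernel_perm_eq (R : realType) (S : Type) (m n : nat)
    (h : m.-tuple S -> R) (x : 'I_n -> S) (s t : m.-tuple 'I_n) :
  symmetric_kernel h -> perm_eq s t ->
  h [tuple of map x s] = h [tuple of map x t].
Proof.
move=> symh /tuple_permP[p sp].
rewrite -(symh p [tuple of map x t]); last first.
  by exists (p^-1)%g; [exact: permK|exact: permKV].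
congr h; apply/val_inj => /=; rewrite sp -map_comp; apply: eq_map => j /=.
by rewrite tnth_map.
Qed.

(** Indices [1 <= i_1 < .. < i_m <= n.+1] are shifted down by one, and symmetry
    replaces increasing tuples by tuples without repetition; the factor [m!]
    turns the binomial coefficient into a falling factorial. *)
Lemma ustatE (d : measure_display) (Omega : measurableType d) (S : Type)
    (R : realType) (X : int -> Omega -> S) (m n : nat)
    (h : m.-tuple S -> R) (w : Omega) : symmetric_kernel h ->
  ustat X h n.+1 w = ((n.+1 ^_ m)%:R)^-1 *
    \sum_(t : m.-tuple 'I_n.+1 | uniq t)
      h [tuple of map (fun k : 'I_n.+1 => X k.+1%:Z w) t].
Proof.
move=> symh.
rewrite sum_uniq_sorted; last first.
  by move=> s t; exact: symmetric_kernel_perm_eq.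
rewrite -bin_ffact natrM invfM mulrA -[_^-1 * _^-1 * _]mulrA mulVf ?mulr1; last first.
  by rewrite pnatr_eq0 -lt0n fact_gt0.
rewrite /ustat; congr (_ * _).
pose shift (t : m.-tuple 'I_n.+1) := [tuple of map (lift ord0) t].
pose unshift (i : m.-tuple 'I_n.+2) :=
  [tuple of map (fun k => odflt ord0 (unlift ord0 k)) i].
have shiftK t : unshift (shift t) = t.
  apply: val_inj => /=; rewrite -map_comp -[RHS]map_id; apply: eq_map => k /=.
  by rewrite liftK.
have shiftP t : path ltn 0 (map val (shift t)) = sorted ltn (map val t).
  rewrite /= -map_comp.
  rewrite (@eq_map _ _ _ (succn \o val)) // map_comp.
  by case: (map val t) => //= a l; rewrite path_map.
rewrite (reindex_onto shift unshift) /=; last first.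
  move=> i pi; apply: val_inj => /=; rewrite -map_comp -[RHS]map_id.
  apply/eq_in_map => k ki /=.
  have k0 : (0 < k)%N.
    have := pi; rewrite path_sortedE; last exact: ltn_trans.
    by move=> /andP[/allP + _]; apply; apply/mapP; exists k.
  case: unliftP => [j ->//|k0']; by rewrite k0' in k0.
apply: eq_big => [t|t _]; first by rewrite shiftK eqxx andbT shiftP.
by congr h; apply: eq_from_tnth => j; rewrite !tnth_map tnth_ord_tuple.
Qed.

Lemma ffact_ratio_cvg (R : realType) (m : nat) :
  (n ^_ m)%:R / n%:R ^+ m @[n --> \oo] --> (1 : R).
Proof.
under eq_fun do rewrite ffact_prod natr_prod -[in X in _ ^+ X](card_ord m)
  -exprVn -prodr_const -big_split/=.
suff : \prod_(i < m) ((n - i)%:R * n%:R^-1) @[n --> \oo] --> \prod_(i < m) (1 : R).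
  by rewrite big1_eq.
apply: cvg_big => [|j _]; first exact: mul_continuous.
have : 1 - j%:R * n%:R^-1 @[n --> \oo] --> (1 - j%:R * 0 : R).
  apply: cvgB; [exact: cvg_cst|apply: cvgMr].
  apply/gtr0_cvgV0; last exact: cvgr_idn.
  by exists 1%N => // n /= n1; rewrite ltr0n.
rewrite mulr0 subr0; apply: cvg_trans; apply: near_eq_cvg.
exists j.+1 => // n /= jn.
rewrite natrB; last exact: ltnW.
by rewrite mulrBl divff // pnatr_eq0 -lt0n (leq_trans _ jn).
Qed.

(** Both passing from all tuples to those without repetition and changing the
    normalization from [n ^ m] to the falling factorial cost at most
    [K * (1 - n ^_ m / n ^ m)]. *)
Lemma uniq_average_cvg (R : realType) (S : Type) (m : nat)
    (h : m.-tuple S -> R) (x : nat -> S) (K l : R) :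
  (forall t, `|h t| <= K) ->
  (n%:R ^+ m)^-1 * \sum_(i : m.-tuple 'I_n) h [tuple of map (fun k : 'I_n => x k) i]
    @[n --> \oo] --> l ->
  ((n ^_ m)%:R)^-1 *
    \sum_(i : m.-tuple 'I_n | uniq i) h [tuple of map (fun k : 'I_n => x k) i]
    @[n --> \oo] --> l.
Proof.
move=> hK cvV.
pose V n := (n%:R ^+ m)^-1 *
  \sum_(i : m.-tuple 'I_n) h [tuple of map (fun k : 'I_n => x k) i].
pose U n := ((n ^_ m)%:R)^-1 *
    \sum_(i : m.-tuple 'I_n | uniq i) h [tuple of map (fun k : 'I_n => x k) i].
pose q n : R := (n ^_ m)%:R / n%:R ^+ m.
suff cv0 : U n - V n @[n --> \oo] --> (0 : R).
  rewrite -/U; have -> : U = (fun n => (U n - V n) + V n).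
    by apply/funext => n; rewrite subrK.
  by rewrite -[l]add0r; exact: cvgD.
have cvq : (K + K) * (1 - q n) @[n --> \oo] --> (0 : R).
  suff : (K + K) * (1 - q n) @[n --> \oo] --> (K + K) * (1 - 1) by rewrite subrr mulr0.
  by apply: cvgMr; apply: cvgB; [exact: cvg_cst|exact: ffact_ratio_cvg].
have cvqN : - ((K + K) * (1 - q n)) @[n --> \oo] --> (0 : R).
  by rewrite -oppr0; exact: cvgN.
apply: (squeeze_cvgr _ cvqN cvq).
exists m.+1 => // n /= mn; rewrite -ler_norml.
have n0 : 0 < n%:R ^+ m :> R by rewrite exprn_gt0// ltr0n (leq_ltn_trans _ mn).
have f0 : 0 < (n ^_ m)%:R :> R by rewrite ltr0n ffact_gt0 ltnW.
pose H (i : m.-tuple 'I_n) := h [tuple of map (fun k : 'I_n => x k) i].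
have nuniq := card_uniq_tuple_ord m n.
have nall : (\sum_(i : m.-tuple 'I_n | uniq i) 1 +
    \sum_(i : m.-tuple 'I_n | ~~ uniq i) 1)%N = (n ^ m)%N.
  by rewrite -(bigID (fun i : m.-tuple 'I_n => uniq i) xpredT)/= sum1_card
    card_tuple card_ord.
have nnuniq : #|[pred i : m.-tuple 'I_n | ~~ uniq i]|%:R =
    n%:R ^+ m - (n ^_ m)%:R :> R.
  by rewrite -natrX -nall !sum1_card nuniq natrD addrC addKr.
have sumb (p : pred (m.-tuple 'I_n)) : `|\sum_(i | p i) H i| <= K * #|p|%:R.
  apply: le_trans (ler_norm_sum _ _ _) _.
  by rewrite mulr_natr -sumr_const; apply: ler_sum => i _; exact: hK.
have -> : U n - V n = ((n ^_ m)%:R^-1 - (n%:R ^+ m)^-1) *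
      \sum_(i : m.-tuple 'I_n | uniq i) H i
    - (n%:R ^+ m)^-1 * \sum_(i : m.-tuple 'I_n | ~~ uniq i) H i.
  rewrite /U /V (bigID (fun i : m.-tuple 'I_n => uniq i) xpredT)/= -/H.
  by rewrite mulrDr mulrBl opprD addrA.
have q1 : (n%:R ^+ m)^-1 <= (n ^_ m)%:R^-1 :> R.
  rewrite lef_pV2 ?posrE// -natrX ler_nat -nall sum1_card nuniq; exact: leq_addr.
rewrite (le_trans (ler_normB _ _))// [leRHS]mulrDl lerD//.
  rewrite normrM ger0_norm ?subr_ge0//.
  apply: le_trans (ler_wpM2l _ (sumb _)) _; first by rewrite subr_ge0.
  by rewrite nuniq mulrCA mulrBl mulVf ?gt_eqF// [X in 1 - X]mulrC.
rewrite normrM ger0_norm ?invr_ge0 ?(ltW n0)//.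
apply: le_trans (ler_wpM2l _ (sumb _)) _; first by rewrite invr_ge0 ltW.
by rewrite nnuniq mulrCA mulrBr mulVf ?gt_eqF// [X in 1 - X]mulrC.
Qed.

(** * Inequalities for powers and truncation *)

Section powR_inequalities.
Context (R : realType) (p : R).
Hypothesis p1 : 1 <= p.

Let p0 : 0 < p. Proof. exact: lt_le_trans p1. Qed.

(** A linear substitute for Jensen's inequality: it can be averaged term by term,
    and [c] is optimized afterwards. *)
Lemma le_add_powR (c x : R) : 0 < c -> 0 <= x -> x <= c + c `^ (1 - p) * x `^ p.
Proof.
move=> c0 x0; have [xc|cx] := leP x c.
  by rewrite (le_trans xc)// lerDl mulr_ge0// powR_ge0.
have xp : 0 < x by exact: lt_trans cx.
rewrite (@le_trans _ _ (c `^ (1 - p) * x `^ p))//; last by rewrite lerDr ltW.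
have xE : x `^ (1 - p) * x `^ p = x.
  by rewrite -powRD ?subrK ?powRr1// (gt_eqF xp) implybT.
rewrite -{1}xE ler_wpM2r ?powR_ge0//.
have -> : 1 - p = - (p - 1) by rewrite opprB.
rewrite !powRN lef_pV2 ?posrE ?powR_gt0//.
by rewrite ge0_ler_powR ?nnegrE ?subr_ge0// ltW.
Qed.

(** Applied to [a] the average of a function and [b] the average of its [p]-th
    power, this is Jensen's inequality up to the constant [2 `^ p]. *)
Lemma powR_le_of_add (a b : R) : 0 <= a -> 0 <= b ->
  (forall c, 0 < c -> a <= c + c `^ (1 - p) * b) -> a `^ p <= 2 `^ p * b.
Proof.
move=> a0 b0 H; have [b00|b_neq0] := eqVneq b 0.
  have -> : a = 0.
    apply/eqP; rewrite eq_le a0 andbT; apply/ler_addgt0Pr => e e0.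
    by have := H e e0; rewrite b00 mulr0 add0r addr0.
  by rewrite powR0 ?gt_eqF// mulr_ge0// powR_ge0.
have bp : 0 < b by rewrite lt_neqAle eq_sym b_neq0.
(* This c balances the two terms: each of them equals c. *)
pose c := b `^ p^-1; have c0 : 0 < c by rewrite powR_gt0.
have cp : c `^ p = b by rewrite -powRrM mulVf ?gt_eqF// powRr1.
have a2c : a <= 2 * c.
  apply: le_trans (H c c0) _; rewrite mulr_natl mulr2n lerD2l -cp.
  rewrite -powRD; last by rewrite (gt_eqF c0) implybT.
  by rewrite subrK powRr1// ltW.
rewrite -cp -powRM//; last exact: ltW.
by rewrite ge0_ler_powR ?nnegrE ?(ltW p0)// mulr_ge0// ltW.
Qed.

Lemma powR_add3_le (a b c : R) :
  `|a + b + c| `^ p <= 3 `^ p * (`|a| `^ p + `|b| `^ p + `|c| `^ p).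
Proof.
have le3 (x : R) : `|x| <= Num.max `|a| (Num.max `|b| `|c|) ->
    `|x| `^ p <= `|a| `^ p + `|b| `^ p + `|c| `^ p.
  have := powR_ge0 `|a| p; have := powR_ge0 `|b| p; have := powR_ge0 `|c| p.
  move=> ? ? ?; rewrite !le_max => /or3P[] /(ge0_ler_powR (ltW p0)) H;
    (apply: le_trans (H _ _) _; rewrite ?nnegrE//; lra).
pose M := Num.max `|a| (Num.max `|b| `|c|).
have M0 : 0 <= M by rewrite le_max normr_ge0.
have abcM : `|a + b + c| <= 3 * M.
  have : `|a| <= M by rewrite le_max lexx.
  have : `|b| <= M by rewrite !le_max lexx orbT.
  have : `|c| <= M by rewrite !le_max lexx !orbT.
  have := ler_normD (a + b) c; have := ler_normD a b; lra.
apply: (@le_trans _ _ ((3 * M) `^ p)).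
  by rewrite ge0_ler_powR ?nnegrE ?(ltW p0)// mulr_ge0.
by rewrite powRM// ler_wpM2l ?powR_ge0// -{1}(ger0_norm M0) le3// ger0_norm.
Qed.

Lemma norm_powR_cvg0 (u : nat -> R) : u @ \oo --> 0 -> `|u n| `^ p @[n --> \oo] --> 0.
Proof.
move=> /cvgrPdist_le cu; apply/cvgrPdist_le => e e0.
have e1 : 0 < Num.min e 1 by rewrite lt_min e0 ltr01.
have := cu _ e1; apply: filterS => n; rewrite !sub0r !normrN le_min => /andP[ue u1].
rewrite ger0_norm ?powR_ge0//; apply: le_trans ue.
have [->|un0] := eqVneq `|u n| 0; first by rewrite powR0 ?gt_eqF.
rewrite -[leRHS]powRr1//; apply: ger_powR => //.
by rewrite u1 andbT lt_neqAle eq_sym un0 normr_ge0.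
Qed.

End powR_inequalities.

Section clip.
Context (R : realType).
Implicit Types K y : R.

Definition clip K y : R := Num.max (- K) (Num.min y K).

Lemma clip_le K y : 0 <= K -> `|clip K y| <= K.
Proof.
move=> K0; rewrite ler_norml /clip le_max lexx /= ge_max ge_min lexx orbT andbT.
by rewrite (le_trans _ K0)// oppr_le0.
Qed.

Lemma clip_diff K y : 0 <= K -> `|y - clip K y| <= `|y| * (K < `|y|)%R%:R.
Proof.
move=> K0; rewrite /clip; case: (leP y K) => yK.
  case: (leP (- K) y) => Ky; first by rewrite subrr normr0 mulr_ge0.
  have y0 : y < 0 by lra.
  rewrite (ltr0_norm y0) (_ : K < - y)//; last by lra.
  by rewrite mulr1 ltr0_norm; lra.
have y0 : 0 < y by lra.
rewrite (gtr0_norm y0) yK mulr1; case: (leP (- K) K) => KK; last by lra.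
by rewrite ger0_norm; lra.
Qed.

Lemma clip_continuous K : continuous (clip K).
Proof.
move=> y; apply: (@continuous_max _ _ (cst (- K)) (fun y => Num.min y K)).
  exact: cvg_cst.
apply: (@continuous_min _ _ id (cst K)); [exact: cvg_id|exact: cvg_cst].
Qed.

End clip.

(** * Bounds on U-statistics *)

Lemma ae_forall_count (d : measure_display) (Omega : measurableType d)
    (R : realType) (P : {measure set Omega -> \bar R}) (I : countType)
    (Q : I -> Omega -> Prop) :
  (forall i, {ae P, forall w, Q i w}) -> {ae P, forall w, forall i, Q i w}.
Proof.
move=> aeQ; have := @ae_foralln _ _ _ P
  (fun n w => if unpickle n is Some i then Q i w else True).
move=> H; have : forall n, {ae P, forall w,
    if @unpickle I n is Some i then Q i w else True}.
  by move=> n; case: unpickle => [i|]; [exact: aeQ|exact: aeW].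
move=> /H; apply: filterS => w Qw i; have := Qw (pickle i).
by rewrite pickleK.
Qed.

Section ustat_bounds.
Context (d : measure_display) (Omega : measurableType d) (R : realType)
  (S : Type) (X : int -> Omega -> S) (m : nat).
Implicit Types g h : m.-tuple S -> R.

Lemma ustatD g h n w :
  ustat X (fun t => g t + h t) n w = ustat X g n w + ustat X h n w.
Proof. by rewrite /ustat big_split mulrDr. Qed.

Lemma ustatZ a h n w : ustat X (fun t => a * h t) n w = a * ustat X h n w.
Proof. by rewrite /ustat -mulr_sumr mulrCA. Qed.

Lemma ustat_le g h n w : (forall t, g t <= h t) -> ustat X g n w <= ustat X h n w.
Proof.
by move=> gh; rewrite ler_wpM2l ?invr_ge0//; apply: ler_sum => i _; exact: gh.
Qed.

Lemma norm_ustat_le h n w : `|ustat X h n w| <= ustat X (fun t => `|h t|) n w.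
Proof.
rewrite normrM ger0_norm ?invr_ge0// ler_wpM2l ?invr_ge0//.
exact: ler_norm_sum.
Qed.

Lemma ustat_ge0 h n w : (forall t, 0 <= h t) -> 0 <= ustat X h n w.
Proof. by move=> h0; rewrite mulr_ge0 ?invr_ge0// sumr_ge0. Qed.

(** The weights of a U-statistic have sum [1], or [0] when [n.+1 < m]. *)
Lemma ustat_cst1_le n w : ustat X (fun _ : m.-tuple S => 1 : R) n.+1 w <= 1.
Proof.
rewrite ustatE// sumr_const.
rewrite (card_uniq_tuple_ord m n.+1).
have [->|f0] := eqVneq (n.+1 ^_ m)%N 0%N; first by rewrite mulr0.
by rewrite mulVf// pnatr_eq0.
Qed.

Lemma norm_ustat_bound h K n w : 0 <= K -> (forall t, `|h t| <= K) ->
  `|ustat X h n.+1 w| <= K.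
Proof.
move=> K0 hK; apply: le_trans (norm_ustat_le _ _ _) _.
apply: le_trans (@ustat_le _ (fun t => K * 1) _ _ _) _.
  by move=> t; rewrite mulr1.
by rewrite ustatZ ler_piMr// ustat_cst1_le.
Qed.

Lemma powR_norm_ustat_le h (p : R) n w : 1 <= p ->
  `|ustat X h n.+1 w| `^ p <= 2 `^ p * ustat X (fun t => `|h t| `^ p) n.+1 w.
Proof.
move=> p1; apply: powR_le_of_add => //.
  by apply: ustat_ge0 => t; exact: powR_ge0.
move=> c c0; apply: le_trans (norm_ustat_le _ _ _) _.
apply: le_trans (@ustat_le _ (fun t => c * 1 + c `^ (1 - p) * `|h t| `^ p) _ _ _) _.
  by move=> t; rewrite mulr1 le_add_powR.
by rewrite ustatD !ustatZ lerD2r ler_piMr ?ustat_cst1_le ?ltW.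
Qed.

End ustat_bounds.

Section ustat_integral.
Context (d : measure_display) (Omega : measurableType d) (R : realType)
  (P : probability Omega R) (d' : measure_display) (S : measurableType d')
  (X : int -> Omega -> S) (m : nat).
Hypothesis mX : forall k : nat, measurable_fun setT (X k%:Z).

Lemma measurable_sample (i : 'I_m -> nat) :
  measurable_fun setT (fun w => [tuple X (i j)%:Z w | j < m]).
Proof.
apply/measurable_fun_tnthP => j.
rewrite (_ : _ \o _ = X (i j)%:Z); first exact: mX.
by apply/funext => w /=; rewrite tnth_mktuple.
Qed.

Lemma measurable_ustat (h : m.-tuple S -> R) n : measurable_fun setT h ->
  measurable_fun setT (ustat X h n).
Proof.
move=> mh; apply: measurable_funM => //.
rewrite /=; under eq_fun do rewrite big_mkcond /=.
apply: measurable_sum => i; case: (path _ _ _) => //.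
apply: (measurableT_comp mh); exact: (measurable_sample (fun j => tnth i j)).
Qed.

Lemma integral_ustat_le (h : m.-tuple S -> R) (e : R) n :
  measurable_fun setT h -> (forall t, 0 <= h t) -> 0 <= e ->
  (forall i : m.-tuple nat, path ltn 0%N i ->
    (\int[P]_w (h [tuple X (tnth i j)%:Z w | j < m])%:E <= e%:E)%E) ->
  (\int[P]_w (ustat X h n.+1 w)%:E <= e%:E)%E.
Proof.
move=> mh h0 e0 he.
pose Q (i : m.-tuple 'I_n.+2) := path ltn 0%N (map val i).
pose H (i : m.-tuple 'I_n.+2) w := h [tuple X (tnth i j : nat)%:Z w | j < m].
have mH i : measurable_fun setT (H i).
  apply: (measurableT_comp mh); exact: (measurable_sample (fun j => tnth i j)).
have c0 : 0 <= (('C(n.+1, m))%:R)^-1 :> R by rewrite invr_ge0.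
under eq_integral do rewrite EFinM.
rewrite ge0_integralZl//; last 2 first.
- apply/measurable_EFinP; rewrite /=; under eq_fun do rewrite big_mkcond /=.
  by apply: measurable_sum => i; case: (path _ _ _) => //; exact: mH.
- by move=> w _; rewrite lee_fin sumr_ge0.
under eq_integral do rewrite -sumEFin -big_filter.
rewrite ge0_integral_sum//; last 2 first.
- by move=> i; apply/measurable_EFinP; exact: mH.
- by move=> i w _; rewrite lee_fin h0.
rewrite big_filter.
have le1 : ('C(n.+1, m)%:R)^-1 * \sum_(i | Q i) e <= e.
  have : ('C(n.+1, m)%:R)^-1 * \sum_(i | Q i) (1 : R) <= 1.
    by have := @ustat_cst1_le _ _ R _ X m n point.
  have -> : \sum_(i | Q i) e = e * \sum_(i | Q i) 1.
    by rewrite mulr_sumr; apply: eq_bigr => i _; rewrite mulr1.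
  by rewrite mulrCA => ?; rewrite ler_piMr.
apply: le_trans (_ : ((('C(n.+1, m)%:R)^-1)%:E * (\sum_(i | Q i) e)%:E <= _)%E);
  last by rewrite -EFinM lee_fin.
apply: lee_wpmul2l => //; rewrite -sumEFin; apply: lee_sum => i Qi.
have := he [tuple of map val i] Qi; congr (_ <= _)%E.
apply: eq_integral => w _; congr (h _)%:E.
by apply: eq_from_tnth => j; rewrite !tnth_mktuple tnth_map.
Qed.

End ustat_integral.

(** * Convergence in L^p *)

Section clipped_kernel.
Context (R : realType) (S : topologicalType) (m : nat).
Implicit Type h : m.-tuple S -> R.

Lemma discontinuity_set_clip (K : R) h :
  discontinuity_set (clip K \o h) `<=` discontinuity_set h.
Proof.
move=> t; apply: contra_not => ct.
apply: (@continuous_comp _ _ _ (fun x : {ptws 'I_m -> S} => h [tuple x j | j < m])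
  (clip K)) => //; exact: clip_continuous.
Qed.

End clipped_kernel.

Lemma powR_Rintegral_le (d : measure_display) (S : measurableType d) (R : realType)
    (nu : probability S R) (g : S -> R) (p : R) : 1 <= p -> measurable_fun setT g ->
  ((`|\int[nu]_x g x| `^ p)%:E <=
     (2 `^ p)%:E * \int[nu]_x (`|g x| `^ p)%:E)%E.
Proof.
move=> p1 mg; have p0 : 0 < p by exact: lt_le_trans p1.
have I0 : (0 <= \int[nu]_x (`|g x| `^ p)%:E)%E.
  by apply: integral_ge0 => x _; rewrite lee_fin powR_ge0.
have mgp : measurable_fun setT (fun x => `|g x| `^ p).
  by apply: (measurableT_comp (measurable_powR _)); exact: measurableT_comp.
have [foo|] := ltP (\int[nu]_x (`|g x| `^ p)%:E)%E +oo%E; last first.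
  by rewrite leye_eq => /eqP ->; rewrite gt0_muley ?leey// lte_fin powR_gt0.
have igp : nu.-integrable setT (EFin \o (fun x => `|g x| `^ p)).
  apply/integrableP; split; first exact/measurable_EFinP.
  by under eq_integral do rewrite /= ger0_norm ?powR_ge0//.
have icst c : nu.-integrable setT (EFin \o cst c).
  by apply: (bounded_integrable nu (C := `|c|)).
have ibound c : nu.-integrable setT (EFin \o (fun x => c + c `^ (1 - p) * `|g x| `^ p)).
  exact: (integrableD measurableT (icst c)
    (integrableZl measurableT (c `^ (1 - p)) igp)).
have ig : nu.-integrable setT (EFin \o g).
  apply: le_integrable (ibound 1) => //; first exact/measurable_EFinP.
  move=> x _ /=; rewrite lee_fin (le_trans (le_add_powR p1 ltr01 (normr_ge0 _)))//.
  exact: ler_norm.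
rewrite -(fineK (x := integral _ _ _)) ?ge0_fin_numE// -EFinM lee_fin.
apply: powR_le_of_add => // [|c c0]; first exact: fine_ge0.
apply: le_trans (le_normr_Rintegral _ ig) _ => //.
apply: (@le_trans _ _ (\int[nu]_x (c + c `^ (1 - p) * `|g x| `^ p))).
  apply: le_Rintegral => //; last by move=> x _; exact: le_add_powR.
  by have := integrable_norm ig.
rewrite (@RintegralD _ _ _ _ _ _ _ measurableT (icst c)); last first.
  exact: (integrableZl measurableT (c `^ (1 - p)) igp).
rewrite RintegralZl// Rintegral_cst// lerD2r.
rewrite [X in c * X](_ : _ = 1) ?mulr1//.
exact: (congr1 fine (probability_setT nu)).
Qed.

Section Lp_convergence.
Context (R : realType) (d : measure_display) (Omega : measurableType d)
  (P : probability Omega R) (T Tinv : Omega -> Omega).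
Hypothesis T_mp : measure_preserving P T.
Context (S : pmetricType R).
Hypothesis S_separable : exists2 D : set S, countable D & dense D.
Context (X0 : Omega -> borel S).
Hypothesis mX0 : measurable_fun setT X0.
Context (mu : Omega -> probability (borel S) R).
Hypothesis mu_cond : is_regular_cond_distribution P (invariant_sets T) X0 mu.
Context (m : nat).

Let X := fun i : int => X0 \o int_iter T Tinv i.

Let mX (k : nat) : measurable_fun setT (X k%:Z).
Proof. by apply: (measurableT_comp mX0); exact: (measurable_iter T_mp k). Qed.

Let mmu A : measurable A -> measurable_fun setT (fun w => mu w A).
Proof. exact: (cond_distribution_measurable mu_cond). Qed.

(** There are countably many cells, so off one null set all their frequencies
    converge; there [Vstat_cvg] applies to the sample, pathwise. *)
Lemma bounded_ustat_cvg (h : m.-tuple (borel S) -> R) (K : R) :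
  measurable_fun setT h -> (forall t, `|h t| <= K) -> symmetric_kernel h ->
  {ae P, forall w, multi_integral (mu w)
      (\1_(discontinuity_set (h : m.-tuple S -> R)) : _ -> R) = 0%E} ->
  {ae P, forall w, ustat X h n.+1 w @[n --> \oo] -->
     \int[power_prob (mu w) m]_t h t}.
Proof.
move=> mh hK symh Dh.
have [B [openB baseB]] := separable_base S_separable.
have freq : {ae P, forall w, forall N i,
    n%:R^-1 * \sum_(k < n) \1_(base_code B N @^-1` [set i]) (X0 (iter k.+1 T w))
     @[n --> \oo] --> fine (mu w (base_code B N @^-1` [set i]))}.
  apply: ae_foralln => N; apply: ae_forall_count => i.
  apply: (empirical_cvg T_mp mX0 mu_cond); exact: measurable_base_code.
apply: filterS2 Dh freq => w Dw fw.
have := Vstat_cvg openB baseB mh hK Dw (x := fun k => X0 (iter k.+1 T w)) fw.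
move/(uniq_average_cvg (x := fun k => X0 (iter k.+1 T w)) hK) => cvU.
under eq_fun do rewrite ustatE//.
by move: cvU; rewrite -cvg_shiftS.
Qed.

Context (h : m.-tuple (borel S) -> R) (p : R).
Hypothesis p_ge1 : 1 <= p.
Hypothesis mh : measurable_fun setT h.

Let p_gt0 : 0 < p. Proof. exact: lt_le_trans p_ge1. Qed.

(** A bound for the [p]-th power of the part of [h] beyond the level [k]. *)
Let tail (k : R) (t : m.-tuple (borel S)) : R :=
  `|h t| `^ p * (k < `|h t|)%R%:R.

Let mpow (g : m.-tuple (borel S) -> R) : measurable_fun setT g ->
  measurable_fun setT (fun t => `|g t| `^ p).
Proof.
by move=> mg; apply: (measurableT_comp (measurable_powR _)); exact: measurableT_comp.
Qed.

Let mtail k : measurable_fun setT (tail k).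
Proof.
apply: measurable_funM; first exact: mpow.
rewrite (_ : (fun t => _) = \1_[set t | k < `|h t|]).
  by apply/measurable_indic/measurable_ltr_set => //; exact: measurableT_comp.
apply/funext => t; rewrite indicE; congr (_%:R); congr nat_of_bool.
by apply/idP/idP; rewrite inE.
Qed.

Let tail_ge0 k t : 0 <= tail k t.
Proof. by rewrite mulr_ge0// powR_ge0. Qed.

Let tail_le k t : tail k t <= `|h t| `^ p.
Proof. by rewrite ler_piMr ?powR_ge0// lern1 leq_b1. Qed.

Let Itail k w := (\int[power_prob (mu w) m]_t (tail k t)%:E)%E.

Let mItail k : measurable_fun setT (Itail k).
Proof. exact: measurable_multi_integral. Qed.

Let Imoment w := multi_integral (mu w) (fun x => `|h x| `^ p)%R.
Hypothesis Ih : (\int[P]_w Imoment w < +oo)%E.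

Let Imoment_ge0 w : (0 <= Imoment w)%E.
Proof. by apply: integral_ge0 => x _; rewrite lee_fin powR_ge0. Qed.

Let integrable_Imoment : P.-integrable setT Imoment.
Proof.
apply/integrableP; split.
  by apply: measurable_multi_integral => //; exact: mpow.
by under eq_integral do rewrite gee0_abs//.
Qed.

Let integrable_moment_ae : {ae P, forall w,
  (power_prob (mu w) m).-integrable setT (EFin \o (fun x => `|h x| `^ p))}.
Proof.
have := integrable_ae measurableT integrable_Imoment.
apply: filterS => w /(_ I) Iw; apply/integrableP; split.
  by apply/measurable_EFinP; exact: mpow.
under eq_integral do rewrite /= ger0_norm ?powR_ge0//.
by move: Iw; rewrite ge0_fin_numE.
Qed.

(** Dominated convergence twice: for almost every [w] under the product measure,
    then under [P]. *)
Lemma integral_tail_cvg0 : (\int[P]_w Itail k%:R w)%E @[k --> \oo] --> 0%E.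
Proof.
have Itail0 k w : (0 <= Itail k w)%E.
  by apply: integral_ge0 => x _; rewrite lee_fin.
have [|||||_ _] := @dominated_convergence _ _ _ P setT measurableT
  (fun k : nat => Itail k%:R) (cst 0%E) Imoment.
- by move=> k; exact: mItail.
- exact: measurable_cst.
- apply: filterS integrable_moment_ae => w ih _.
  have [|||||_ _] := @dominated_convergence _ _ _ (power_prob (mu w) m)
    setT measurableT (fun k : nat => EFin \o tail k%:R) (cst 0%E)
    (EFin \o (fun x => `|h x| `^ p)).
  + by move=> k; exact/measurable_EFinP.
  + exact: measurable_cst.
  + apply: aeW => x _; apply: cvg_near_cst.
    exists (Num.truncn `|h x|).+1 => // k /= kx; rewrite /tail.
    rewrite ltNge (_ : (`|h x| <= k%:R) = true) ?mulr0//.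
    by rewrite ltW// (lt_le_trans (truncnS_gt _))// ler_nat.
  + exact: ih.
  + by apply: aeW => x k _ /=; rewrite lee_fin ger0_norm.
  by rewrite integral0.
- exact: integrable_Imoment.
- apply: aeW => w k _; rewrite gee0_abs//; apply: ge0_le_integral => //.
  + by move=> x _; rewrite lee_fin.
  + exact/measurable_EFinP.
  + by apply/measurable_EFinP; exact: mpow.
  + by move=> x _; rewrite lee_fin.
by rewrite integral0.
Qed.

Let J (g : m.-tuple (borel S) -> R) w := \int[power_prob (mu w) m]_t g t.

Let mJ g : measurable_fun setT g -> measurable_fun setT (J g).
Proof.
move=> mg; rewrite /J /Rintegral.
by apply: measurableT_comp => //; exact: measurable_multi_integral.
Qed.

Let mU (g : m.-tuple (borel S) -> R) n : measurable_fun setT g ->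
  measurable_fun setT (ustat X g n).
Proof. exact: measurable_ustat. Qed.

Let mpowO (f : Omega -> R) : measurable_fun setT f ->
  measurable_fun setT (EFin \o (fun w => `|f w| `^ p)).
Proof.
move=> mf; apply/measurable_EFinP.
by apply: (measurableT_comp (measurable_powR _)); exact: measurableT_comp.
Qed.

Let rest K t := h t - clip K (h t).

Let mclip K : measurable_fun setT (clip K \o h).
Proof.
apply: measurableT_comp => //; apply: continuous_measurable_fun.
exact: clip_continuous.
Qed.

Let mrest K : measurable_fun setT (rest K).
Proof. by apply: measurable_funB => //; exact: mclip. Qed.

Let rest_le K t : 0 <= K -> `|rest K t| `^ p <= tail K t.
Proof.
move=> K0; have := clip_diff (h t) K0; rewrite /tail.
case: (K < `|h t|) => /=; rewrite ?mulr1 ?mulr0 => H.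
  by rewrite ge0_ler_powR ?nnegrE ?(ltW p_gt0).
by rewrite (_ : `|rest K t| = 0) ?powR0 ?gt_eqF//; apply/le_anti; rewrite H /=.
Qed.

Hypothesis symh : symmetric_kernel h.
Hypothesis Dh : {ae P, forall w, multi_integral (mu w)
  (\1_(discontinuity_set (h : m.-tuple S -> R)) : _ -> R) = 0%E}.
Hypothesis ui : uniformly_integrable P [set i : m.-tuple nat | path ltn 0%N i]
  (fun i w => `|h [tuple X (tnth i j)%:Z w | j < m]| `^ p).

(** Almost sure convergence of bounded variables implies convergence in L^p. *)
Let clip_part K e : 0 <= K -> 0 < e -> \forall n \near \oo,
  (\int[P]_w (`|ustat X (clip K \o h) n.+1 w - J (clip K \o h) w| `^ p)%:E
   <= e%:E)%E.
Proof.
move=> K0 e0; set hc := clip K \o h.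
have hcK t : `|hc t| <= K by exact: clip_le.
have symc : symmetric_kernel hc by move=> s x bs; rewrite /hc /= symh.
have Dc : {ae P, forall w, multi_integral (mu w)
    (\1_(discontinuity_set (hc : m.-tuple S -> R)) : _ -> R) = 0%E}.
  apply: filterS Dh => w Dw; apply/eqP; rewrite eq_le; apply/andP; split.
    rewrite -Dw; apply: le_lower_integral => x; first by rewrite lee_fin.
    rewrite lee_fin !indicE ler_nat; case: (boolP (x \in _)) => // /set_mem xD.
    by rewrite mem_set//; exact: discontinuity_set_clip xD.
  by apply: integral_ge0 => x _; rewrite lee_fin.
have cvU := bounded_ustat_cvg (mclip K) hcK symc Dc.
pose f n w := `|ustat X hc n.+1 w - J hc w| `^ p.
have mf n : measurable_fun setT (f n).
  apply/measurable_EFinP; apply: mpowO; apply: measurable_funB.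
    exact: mU (mclip K).
  exact: mJ (mclip K).
have JK w : `|J hc w| <= K.
  have ic : (power_prob (mu w) m).-integrable setT (EFin \o hc).
    exact: bounded_integrable (mclip K) hcK.
  apply: le_trans (le_normr_Rintegral _ ic) _ => //.
  apply: (@le_trans _ _ (\int[power_prob (mu w) m]_t (cst K) t)).
    apply: le_Rintegral => //; first exact: (integrable_norm ic).
    by apply: (bounded_integrable _ (C := `|K|)).
  rewrite Rintegral_cst// [X in K * X](_ : _ = 1) ?mulr1//.
  exact: (congr1 fine (probability_setT (power_prob (mu w) m))).
have fb n w : `|f n w| <= (K + K) `^ p.
  rewrite ger0_norm ?powR_ge0// ge0_ler_powR ?nnegrE ?(ltW p_gt0)// ?addr_ge0//.
  by rewrite (le_trans (ler_normB _ _))// lerD// norm_ustat_bound.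
have : \int[P]_w f n w @[n --> \oo] --> \int[P]_w (fun=> 0 : R) w.
  apply: (Rintegral_cvg_bounded (C := (K + K) `^ p)) => //.
  apply: filterS cvU => w cvw; apply: (norm_powR_cvg0 p_ge1).
  by rewrite -[X in _ --> X](subrr (J hc w)); apply: cvgB => //; exact: cvg_cst.
rewrite Rintegral_cst// mul0r => /cvgrPdist_le/(_ _ e0); apply: filterS => n.
rewrite sub0r normrN => H.
have ifn := bounded_integrable P (mf n) (fb n).
rewrite -(fineK (integrable_fin_num measurableT ifn)) lee_fin.
exact: le_trans (ler_norm _) H.
Qed.

(** Uniform integrability, written with levels of [|h|^p], applies to levels
    [1 <= K] of [|h|]: there [K < |h|] implies [K < |h|^p], as [1 <= p]. *)
Let rest_ustat_part e : 0 < e -> exists K0 : R, forall K, K0 <= K -> 0 <= K ->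
  forall n, (\int[P]_w (`|ustat X (rest K) n.+1 w| `^ p)%:E <= (2 `^ p * e)%:E)%E.
Proof.
move=> e0; have [K' HK'] := ui e0; exists (Num.max 1 K') => K.
rewrite ge_max => /andP[K1 KK'] K0 n.
have mUr : measurable_fun setT (ustat X (fun t => `|rest K t| `^ p) n.+1).
  exact: mU (mpow (mrest K)).
apply: (@le_trans _ _ (\int[P]_w (2 `^ p * ustat X (fun t => `|rest K t| `^ p) n.+1 w)%:E)%E).
  apply: le_lower_integral => w; first by rewrite lee_fin powR_ge0.
  by rewrite lee_fin powR_norm_ustat_le.
under eq_integral do rewrite EFinM.
have U0 w : 0 <= ustat X (fun t => `|rest K t| `^ p) n.+1 w.
  by apply: ustat_ge0 => t; exact: powR_ge0.
rewrite ge0_integralZl//; [|exact/measurable_EFinP|by move=> w _; rewrite lee_fin].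
rewrite EFinM lee_wpmul2l// ?lee_fin ?powR_ge0//.
apply: integral_ustat_le => //; [exact: mpow (mrest K)|exact: ltW|move=> i Pi].
apply: le_trans (HK' i Pi); rewrite [leRHS]integral_mkcond.
apply: le_lower_integral => w; first by rewrite lee_fin powR_ge0.
set t := [tuple _ | _ < _].
rewrite patchE; case: ifPn => [_|].
  rewrite lee_fin [leRHS]ger0_norm ?powR_ge0//.
  exact: le_trans (rest_le _ K0) (tail_le _ _).
rewrite notin_setE /= => /negP; rewrite -leNgt ger0_norm ?powR_ge0// => tK'.
rewrite lee_fin (le_trans (rest_le _ K0))// /tail.
case: ltP => [Kt|]; last by rewrite mulr0.
have := le1r_powR (le_trans K1 (ltW Kt)) p_ge1.
by move=> /(lt_le_trans Kt)/(le_lt_trans KK'); rewrite ltNge tK'.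
Qed.

(** The same bound for the limit, with the tails of [|h|^p] under the mixture of
    the product measures in place of uniform integrability. *)
Let rest_J_part e : 0 < e -> exists K0 : nat, forall k, (K0 <= k)%N ->
  (\int[P]_w (`|J (rest k%:R) w| `^ p)%:E <= (2 `^ p * e)%:E)%E.
Proof.
move=> e0; have /fine_cvgP[finI cvI] := integral_tail_cvg0.
have [K1 _ HK1] := finI.
move/cvgrPdist_le : cvI => /(_ _ e0)[K2 _ HK2].
exists (maxn K1 K2) => k; rewrite geq_max => /andP[k1 k2].
have Itail0 w : (0 <= Itail k%:R w)%E.
  by apply: integral_ge0 => x _; rewrite lee_fin.
apply: (@le_trans _ _ (\int[P]_w ((2 `^ p)%:E * Itail k%:R w))%E).
  apply: le_lower_integral => w; first by rewrite lee_fin powR_ge0.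
  apply: le_trans (powR_Rintegral_le _ p_ge1 (mrest k%:R)) _.
  rewrite lee_wpmul2l// ?lee_fin ?powR_ge0//; apply: le_lower_integral => t.
    by rewrite lee_fin powR_ge0.
  by rewrite lee_fin rest_le.
rewrite ge0_integralZl//.
rewrite EFinM lee_wpmul2l// ?lee_fin ?powR_ge0//.
have := HK2 k k2; rewrite sub0r normrN => H.
rewrite -(fineK (HK1 k k1)) lee_fin; exact: le_trans (ler_norm _) H.
Qed.

(** Almost surely [|h|^p] is integrable for the product measure, and so is [h]
    since [1 <= p]; only then does the integral split along the truncation. *)
Let integral_split_ae : {ae P, forall w, multi_integral (mu w) h = (J h w)%:E /\
  forall K, 0 <= K -> J h w = J (clip K \o h) w + J (rest K) w}.
Proof.
apply: filterS integrable_moment_ae => w ihp.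
have ih : (power_prob (mu w) m).-integrable setT (EFin \o h).
  have i1 : (power_prob (mu w) m).-integrable setT (EFin \o (fun x => 1 + 1 * `|h x| `^ p)).
    have ic : (power_prob (mu w) m).-integrable setT (EFin \o cst (1 : R)).
      by apply: (bounded_integrable _ (C := 1)) => // ?; rewrite normr1.
    exact: (integrableD measurableT ic (integrableZl measurableT 1 ihp)).
  apply: le_integrable i1 => //; first exact/measurable_EFinP.
  move=> x _ /=; rewrite lee_fin.
  have := le_add_powR p_ge1 ltr01 (normr_ge0 (h x)); rewrite powR1 => H.
  by rewrite (le_trans H)// ler_norm.
split=> [|K K0]; first by rewrite fineK//; exact: integrable_fin_num.
have ic : (power_prob (mu w) m).-integrable setT (EFin \o (clip K \o h)).
  by apply: (bounded_integrable _ (C := K)) => [|t]; [exact: mclip|exact: clip_le].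
rewrite /J -RintegralD//.
  by apply: eq_Rintegral => t _; rewrite /= /rest addrC subrK.
exact: (integrableB measurableT ih ic).
Qed.

(** The error splits into the U-statistic of the rest, the error for the clipped
    kernel, and the integral of the rest; the level [k] is fixed before [n]
    grows. *)
Lemma Lp_error_small e : 0 < e -> exists N, forall n, (N <= n)%N ->
  (\int[P]_w (`|ustat X h n.+1 w - J h w| `^ p)%:E <= e%:E)%E.
Proof.
move=> e0; pose c : R := 2 `^ p; pose D : R := 3 `^ p * (c + 1 + c).
have c_gt0 : 0 < c by rewrite powR_gt0.
have D0 : 0 < D by rewrite mulr_gt0 ?powR_gt0//; lra.
have e'0 : 0 < e / D by rewrite divr_gt0.
have [K1 HK1] := rest_ustat_part e'0.
have [K2 HK2] := rest_J_part e'0.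
pose k := maxn K2 (Num.truncn `|K1|).+1.
have kK1 : K1 <= k%:R.
  rewrite (le_trans (ler_norm _))// ltW// (lt_le_trans (truncnS_gt _))//.
  by rewrite ler_nat leq_maxr.
have [N _ HN] := clip_part (ler0n R k) e'0.
exists N => n Nn; pose hc := clip k%:R \o h.
pose f1 w := `|ustat X (rest k%:R) n.+1 w| `^ p.
pose f2 w := `|ustat X hc n.+1 w - J hc w| `^ p.
pose f3 w := `|J (rest k%:R) w| `^ p.
have m1 : measurable_fun setT (EFin \o f1) by exact: (mpowO (mU _ (mrest k%:R))).
have m2 : measurable_fun setT (EFin \o f2).
  apply: (mpowO (f := fun w => ustat X hc n.+1 w - J hc w)).
  by apply: measurable_funB; [exact: mU (mclip _)|exact: mJ (mclip _)].
have m3 : measurable_fun setT (EFin \o f3) by exact: (mpowO (mJ (mrest k%:R))).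
have F1 w : (0 <= (EFin \o f1) w)%E by rewrite lee_fin powR_ge0.
have F2 w : (0 <= (EFin \o f2) w)%E by rewrite lee_fin powR_ge0.
have F3 w : (0 <= (EFin \o f3) w)%E by rewrite lee_fin powR_ge0.
have m12 := emeasurable_funD m1 m2.
have F12 w : (0 <= (EFin \o f1) w + (EFin \o f2) w)%E by rewrite adde_ge0.
apply: (@le_trans _ _ (\int[P]_w ((3 `^ p)%:E *
    ((EFin \o f1) w + (EFin \o f2) w + (EFin \o f3) w))))%E.
  apply: ae_ge0_le_integral => //.
  - apply: (mpowO (f := fun w => ustat X h n.+1 w - J h w)).
    by apply: measurable_funB; [exact: mU|exact: mJ].
  - move=> w _; rewrite mule_ge0 ?lee_fin ?powR_ge0//.
    by rewrite !addr_ge0// powR_ge0.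
  - by apply: measurable_funeM; do 2 apply: emeasurable_funD => //.
  apply: filterS integral_split_ae => w [_ /(_ _ (ler0n R k)) Jw] _.
  rewrite -!EFinD -EFinM lee_fin.
  have Uw : ustat X h n.+1 w = ustat X (rest k%:R) n.+1 w + ustat X hc n.+1 w.
    rewrite -ustatD; congr (ustat X _ _ _); apply/funext => t.
    by rewrite /rest subrK.
  rewrite Uw Jw (_ : _ - _ = ustat X (rest k%:R) n.+1 w +
    (ustat X hc n.+1 w - J hc w) + - J (rest k%:R) w); last by rewrite /hc; lra.
  by apply: le_trans (powR_add3_le p_ge1 _ _ _) _; rewrite normrN.
have F123 w : (0 <= (EFin \o f1) w + (EFin \o f2) w + (EFin \o f3) w)%E.
  by rewrite adde_ge0.
rewrite (@ge0_integralZl _ _ _ P _ measurableT _ (emeasurable_funD m12 m3) _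
  (fun w _ => F123 w)); last by rewrite lee_fin powR_ge0.
rewrite (@ge0_integralD _ _ _ P _ measurableT _ _ (fun w _ => F12 w) m12 (fun w _ => F3 w) m3).
rewrite (@ge0_integralD _ _ _ P _ measurableT _ _ (fun w _ => F1 w) m1 (fun w _ => F2 w) m2).
have -> : e%:E = ((3 `^ p)%:E * ((c * (e / D))%:E + (e / D)%:E + (c * (e / D))%:E))%E.
  rewrite -!EFinD -EFinM; congr (_%:E).
  rewrite -[in X in _ * (_ + X + _)](mul1r (e / D)) -!mulrDl mulrA -/D.
  by rewrite mulrC divfK// gt_eqF.
rewrite lee_wpmul2l// ?lee_fin ?powR_ge0//.
rewrite leeD//; last by apply: HK2; rewrite leq_maxl.
by rewrite leeD//; [exact: HK1|exact: HN].
Qed.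

Lemma Lnorm_ustat_cvg0 :
  (fun n => 'N[P]_(p%:E)[(fun w => (ustat X h n w)%:E - multi_integral (mu w) h)])%E
    @ \oo --> 0%E.
Proof.
have small e : 0 < e -> \forall n \near \oo,
    ('N[P]_(p%:E)[(fun w => (ustat X h n w)%:E - multi_integral (mu w) h)] <= e%:E)%E.
  move=> e0; have ep : 0 < e `^ p by rewrite powR_gt0.
  have [N HN] := Lp_error_small ep; exists N.+1 => // n /=; case: n => [//|n] Nn.
  rewrite unlock.
  have -> : e%:E = ((e `^ p)%:E `^ p^-1)%E.
    by rewrite poweR_EFin -powRrM mulfV ?gt_eqF// powRr1// ltW.
  apply: gt0_ler_poweR; rewrite ?invr_ge0 ?(ltW p_gt0)//.
  - rewrite in_itv /= leey andbT; apply: integral_ge0 => w _; exact: poweR_ge0.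
  - by rewrite in_itv /= leey andbT lee_fin powR_ge0.
  apply: le_trans (HN n Nn); apply: ae_ge0_le_integral => //.
  - by move=> w _; exact: poweR_ge0.
  - apply: (measurableT_comp (measurable_poweR _)).
    apply: measurableT_comp => //; apply: emeasurable_funB.
      by apply/measurable_EFinP; exact: mU.
    exact: measurable_multi_integral.
  - apply: (mpowO (f := fun w => ustat X h n.+1 w - J h w)).
    by apply: measurable_funB; [exact: mU|exact: mJ].
  by apply: filterS integral_split_ae => w [-> _] _; rewrite -EFinB abse_EFin poweR_EFin.
apply/fine_cvgP; split.
  apply: filterS (small 1 ltr01) => n Nn.
  by rewrite ge0_fin_numE ?Lnorm_ge0// (le_lt_trans Nn)// ltry.
apply/cvgrPdist_le => e e0; apply: filterS (small e e0) => n Nn.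
rewrite sub0r normrN ger0_norm ?fine_ge0 ?Lnorm_ge0//.
rewrite -lee_fin fineK// ge0_fin_numE ?Lnorm_ge0//.
by rewrite (le_lt_trans Nn)// ltry.
Qed.

End Lp_convergence.

Theorem corollary1p2 (R : realType)
    (d : measure_display) (Omega : measurableType d) (P : probability Omega R)
    (T Tinv : Omega -> Omega)
    (TK : cancel T Tinv) (TinvK : cancel Tinv T)
    (T_mp : measure_preserving P T) (mTinv : measurable_fun setT Tinv)
    (S : pmetricType R) (S_separable : exists2 D : set S, countable D & dense D)
    (X0 : Omega -> borel S) (mX0 : measurable_fun setT X0)
    (mu : Omega -> probability (borel S) R)
    (mu_cond : is_regular_cond_distribution P (invariant_sets T) X0 mu)
    (m : nat) (m_ge1 : (1 <= m)%N) (p : R) (p_ge1 : 1 <= p)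
    (h : m.-tuple (borel S) -> R) (mh : measurable_fun setT h) :
  let X := fun i : int => X0 \o int_iter T Tinv i in
  symmetric_kernel h ->
  uniformly_integrable P [set i : m.-tuple nat | path ltn 0%N i]
    (fun i w => `|h [tuple X (tnth i j)%:Z w | j < m]| `^ p) ->
  (\int[P]_w multi_integral (mu w) (fun x => `|h x| `^ p)%R < +oo)%E ->
  {ae P, forall w,
    multi_integral (mu w)
      (\1_(discontinuity_set (h : m.-tuple S -> R)) : _ -> R) = 0%E} ->
  (fun n =>
    'N[P]_(p%:E)[(fun w => (ustat X h n w)%:E - multi_integral (mu w) h)])%E
    @ \oo --> 0%E.
Proof.
move=> X symh ui Ih Dh.
exact: (Lnorm_ustat_cvg0 T_mp S_separable mX0 mu_cond p_ge1 mh Ih symh Dh ui).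
Qed.
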